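(* Let $R$ be an almost Dedekind domain which is SP-scattered, and let $\alpha$ be its SP-rank. Then \[ \mathrm{Inv}(R)\simeq\bigoplus_{i<\alpha}\mathcal{C}_c\big(\mathrm{Crit}_i(R)\setminus\mathrm{Crit}_{i+1}(R),\mathbb{Z}\big) \] as abelian groups; in particular, $\mathrm{Inv}(R)$ is a free abelian group.
   Context: An almost Dedekind domain is an integral domain $R$ such that $R_M$ is a discrete valuation ring for every maximal ideal $M$; let $K$ be its quotient field. $\mathrm{Inv}(R)$ is the group of invertible fractional ideals of $R$ under multiplication. $\mathcal{M}$ denotes $\mathrm{Max}(R)$ endowed with the inverse topology (the restriction to $\mathrm{Max}(R)$ of the coarsest topology on $\mathrm{Spec}(R)$ in which every Zariski-open Zariski-compact set is closed; on $\mathrm{Max}(R)$ it coincides with the constructible topology). Subsets of $\mathcal{M}$ carry the subspace topology. For a topological space $X$, $\mathcal{C}_c(X,\mathbb{Z})$ is the group (under pointwise addition) of continuous functions $X\to\mathbb{Z}$ ($\mathbb{Z}$ discrete) with compact support, the support being the closure of the set where the function is nonzero. A maximal ideal $M$ of an almost Dedekind domain $A$ is critical if for every finitely generated ideal $I\subseteq M$ there is a maximal ideal $N$ with $I\subseteq N^2$; $\mathrm{Crit}(A)$ is the set of critical maximal ideals. Define recursively for ordinals $\alpha$: $\mathrm{Crit}_0(R)=\mathrm{Max}(R)$, $T_0=R$; if $\alpha=\gamma+1$, $\mathrm{Crit}_\alpha(R)=\{P\in\mathrm{Max}(R)\mid PT_\gamma\in\mathrm{Crit}(T_\gamma)\}$;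 if $\alpha$ is a limit ordinal, $\mathrm{Crit}_\alpha(R)=\bigcap_{\gamma<\alpha}\mathrm{Crit}_\gamma(R)$; and $T_\alpha=\bigcap\{R_P\mid P\in\mathrm{Crit}_\alpha(R)\}$ (equal to $K$ if the set is empty; each $T_\alpha$ is again almost Dedekind). The SP-rank of $R$ is the least ordinal $\alpha$ with $\mathrm{Crit}_\alpha(R)=\mathrm{Crit}_{\alpha+1}(R)$; $R$ is SP-scattered if $\mathrm{Crit}_\alpha(R)=\emptyset$ for this $\alpha$. *)

(* Defs.v *)
From mathcomp Require Import all_boot all_order all_algebra.
From mathcomp Require Import boolp classical_sets.
Set Implicit Arguments. Unset Strict Implicit. Unset Printing Implicit Defensive.
Import Order.TTheory GRing.Theory Num.Theory.
Local Open Scope classical_set_scope.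
Local Open Scope ring_scope.
From Stdlib Require List.
Notation List_In := List.In.

(* Commutative algebra inside a fixed field K: all rings are subrings of K,  *)
(* all ideals / fractional ideals are subsets of K.                          *)
Section Alg.
Variable K : fieldType.

Definition subring (S : set K) : Prop :=
  S 1 /\ (forall x y, S x -> S y -> S (x - y)) /\ (forall x y, S x -> S y -> S (x * y)).

Definition quotient_field_of (R : set K) : Prop :=
  forall x : K, exists a b, R a /\ R b /\ b != 0 /\ x = a / b.

Definition sr_ideal (S I : set K) : Prop :=
  I `<=` S /\ I 0 /\ (forall x y, I x -> I y -> I (x + y)) /\
  (forall s x, S s -> I x -> I (s * x)).

Definition sr_prime (S P : set K) : Prop :=
  sr_ideal S P /\ P <> S /\ (forall a b, S a -> S b -> P (a * b) -> P a \/ P b).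

Definition sr_maximal (S M : set K) : Prop :=
  sr_ideal S M /\ M <> S /\
  (forall J, sr_ideal S J -> M `<=` J -> J = M \/ J = S).

Definition prod_set (I J : set K) : set K :=
  [set x | exists s : seq (K * K), (forall p, p \in s -> I p.1 /\ J p.2) /\
           x = \sum_(p <- s) p.1 * p.2].

Definition fg_ideal (S I : set K) : Prop :=
  exists s : seq K, (forall x, x \in s -> S x) /\
    I = [set x | exists c : seq K, (forall y, y \in c -> S y) /\ size c = size s /\
                 x = \sum_(i < size s) c`_i * s`_i].

Definition critical (S M : set K) : Prop :=
  sr_maximal S M /\
  forall I, fg_ideal S I -> I `<=` M -> exists N, sr_maximal S N /\ I `<=` prod_set N N.

Definition localization (R P : set K) : set K :=
  [set x | exists a b, R a /\ R b /\ ~ P b /\ x = a / b].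

Definition DVR (V : set K) : Prop :=
  exists v : K -> int,
    (forall x y, x != 0 -> y != 0 -> v (x * y) = v x + v y) /\
    (forall x y, x != 0 -> y != 0 -> x + y != 0 -> Num.min (v x) (v y) <= v (x + y)) /\
    (exists t, t != 0 /\ v t = 1) /\
    V = [set x | x = 0 \/ (x != 0 /\ 0 <= v x)].

Definition almost_dedekind (R : set K) : Prop :=
  subring R /\ quotient_field_of R /\
  forall M, sr_maximal R M -> DVR (localization R M).

Definition Spec (R : set K) : set (set K) := [set P | sr_prime R P].
Definition Max (R : set K) : set (set K) := [set M | sr_maximal R M].

(* T = intersection of the R_P, P in C (= K when C is empty) *)
Definition Tof (R : set K) (C : set (set K)) : set K :=
  [set x | forall P, C P -> localization R P x].

Definition crit_step (R : set K) (C : set (set K)) : set (set K) :=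
  [set P | sr_maximal R P /\ critical (Tof R C) (prod_set P (Tof R C))].

Definition frac_ideal (R J : set K) : Prop :=
  J 0 /\ (forall x y, J x -> J y -> J (x + y)) /\ (forall r x, R r -> J x -> J (r * x)) /\
  exists d, d != 0 /\ R d /\ forall x, J x -> R (d * x).

Definition Inv (R : set K) : set (set K) :=
  [set J | frac_ideal R J /\ exists J', frac_ideal R J' /\ prod_set J J' = R].

End Alg.

(* Elementary topology on subsets of a carrier type T, a topology being    *)
(* given by its family of open sets.                                        *)
Section Top.
Variable T : Type.

(* topology on X generated by the subbase Sb: opens are unions of finite
   intersections of members of Sb (the empty intersection being X) *)
Definition gen_topology (X : set T) (Sb : set (set T)) : set (set T) :=
  [set U | U `<=` X /\ forall x, U x -> exists s : seq (set T),
     (forall B, List_In B s -> Sb B) /\ X x /\ (forall B, List_In B s -> B x) /\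
     [set y | X y /\ forall B, List_In B s -> B y] `<=` U].

Definition subspace (op : set (set T)) (Y : set T) : set (set T) :=
  [set V | exists U, op U /\ V = U `&` Y].

Definition compact_in (op : set (set T)) (A : set T) : Prop :=
  forall F : set (set T), F `<=` op -> A `<=` [set x | exists U, F U /\ U x] ->
  exists s : seq (set T), (forall U, List_In U s -> F U) /\
    A `<=` [set x | exists U, List_In U s /\ U x].

Definition closure_in (op : set (set T)) (Y A : set T) : set T :=
  [set y | Y y /\ forall V, op V -> V y -> exists a, A a /\ V a].

Definition continuous_Z (op : set (set T)) (Y : set T) (f : T -> int) : Prop :=
  forall A : set int, op (Y `&` f @^-1` A).

(* C_c(Y, Z), functions represented as maps T -> int vanishing outside Y *)
Definition Cc (op : set (set T)) (Y : set T) : set (T -> int) :=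
  [set f | (forall x, ~ Y x -> f x = 0) /\ continuous_Z op Y f /\
           compact_in op (closure_in op Y [set y | Y y /\ f y != 0])].

End Top.

Definition zar_open (K : fieldType) (R : set K) (U : set (set K)) : Prop :=
  exists S, S `<=` R /\ U = [set P | sr_prime R P /\ ~ (S `<=` P)].

Definition inv_open (K : fieldType) (R : set K) : set (set (set K)) :=
  gen_topology (Spec R)
    [set Cl | exists U, zar_open R U /\ compact_in (zar_open R) U /\ Cl = Spec R `\` U].

Definition maxtop (K : fieldType) (R : set K) : set (set (set K)) :=
  subspace (inv_open R) (Max R).

(* Transfinite sequences indexed by a well-ordered type                     *)
Definition is_succ (d : Order.disp_t) (I : orderType d) (i j : I) : Prop :=
  (i < j)%O /\ forall k, ~ ((i < k)%O /\ (k < j)%O).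

(* C is the sequence (Crit_i(R))_i: successor and limit (incl. 0) clauses *)
Definition crit_seq (K : fieldType) (R : set K) (d : Order.disp_t) (I : orderType d)
    (C : I -> set (set K)) : Prop :=
  (forall i j, is_succ i j -> C j = crit_step R (C i)) /\
  (forall j, (forall i, ~ is_succ i j) ->
     C j = [set P | sr_maximal R P /\ forall i, (i < j)%O -> C i P]).

Definition crit_layer (K : fieldType) (d : Order.disp_t) (I : orderType d)
    (C : I -> set (set K)) (i : I) : set (set K) :=
  [set P | C i P /\ forall j, is_succ i j -> ~ C j P].

Definition dsum (d : Order.disp_t) (I : orderType d) (T : Type) (alpha : I)
    (G : I -> set (T -> int)) : set (I -> T -> int) :=
  [set f | (forall i, (i < alpha)%O -> G i (f i)) /\
           (forall i, ~ (i < alpha)%O -> f i = fun _ => 0) /\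
           exists s : seq I, forall i, f i <> (fun _ => 0) -> i \in s].

Definition dsum_add (I T : Type) (f g : I -> T -> int) : I -> T -> int :=
  fun i t => f i t + g i t.

Definition set_iso (A B : Type) (G : set A) (H : set B) (opA : A -> A -> A)
    (opB : B -> B -> B) (phi : A -> B) : Prop :=
  (forall x, G x -> H (phi x)) /\
  (forall x y, G x -> G y -> phi x = phi y -> x = y) /\
  (forall z, H z -> exists x, G x /\ phi x = z) /\
  (forall x y, G x -> G y -> phi (opA x y) = opB (phi x) (phi y)).

Definition free_abelian (A : Type) (G : set A) (op : A -> A -> A) : Prop :=
  exists (B : Type) (phi : A -> B -> int),
    set_iso G [set c : B -> int | exists s : seq B, forall b, c b != 0 -> List_In b s]
      op (fun c c' b => c b + c' b) phi.

(* Main.v *)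
From HB Require Import structures.
From mathcomp Require Import all_boot all_order all_algebra.
From mathcomp Require Import boolp classical_sets functions wochoice filter.
From mathcomp Require Import freeg.
From mathcomp Require Import zify ring.
Require Import Defs.
Set Implicit Arguments. Unset Strict Implicit. Unset Printing Implicit Defensive.
Import Order.TTheory GRing.Theory Num.Theory.
Local Open Scope classical_set_scope.
Local Open Scope ring_scope.

(** Write [v_M] for the normalized valuation of a maximal ideal [M].  An
    invertible fractional ideal [J] is determined by its value function
    [M |-> min v_M(J)], so [Inv R] is a group [G] of integer functions on
    [Max R], closed under pointwise minimum.  The sets [{g > 0}], for [g] in [G],
    form a basis of compact open sets of the inverse topology.  For [C] closed in
    [Max R] and [T = Tof R C], the maximal ideals of [T] are the [QT] with [Q] in
    [C], and [QT] is noncritical iff some [g] in [G] has [0 <= g <= 1] on [C] and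
    [g Q = 1].  The critical sequence is thus determined by [G] alone.

    Filter [G] by the subgroups of the functions vanishing on [C i].  By
    compactness the filtration is continuous at limits, and restriction to [C i]
    identifies its graded pieces with [C_c(C i \ C (i+1), Z)].  These are free by
    a form of Nobeling's theorem, so bases of the pieces lift both to a basis of
    [G] and to one of the direct sum, indexed by the same set.

    Nobeling's theorem is itself proved by a filtration.  Well-order the sets in
    question and let [E] consist of those before [V].  Adjoining [V] enlarges the
    [E]-simple functions modulo an ideal [J] of negligible sets by a quotient
    isomorphic to the [E]-simple functions modulo another ideal, so it suffices
    to induct with [J] arbitrary. *)

(** * Bases modulo a subgroup *)

Section Subgroups.
Variable A : zmodType.
Implicit Types H N : set A.

Definition subgroup H := H 0 /\ forall x y, H x -> H y -> H (x - y).

Lemma subgroupN H x : subgroup H -> H x -> H (- x).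
Proof. by case=> H0 HB Hx; rewrite -[- x]add0r; exact: HB. Qed.

Lemma subgroupD H x y : subgroup H -> H x -> H y -> H (x + y).
Proof. by move=> sH Hx Hy; rewrite -[y]opprK; apply: sH.2 => //; exact: subgroupN. Qed.

Lemma subgroup_sum H (J : eqType) (r : seq J) (F : J -> A) : subgroup H ->
  {in r, forall j, H (F j)} -> H (\sum_(j <- r) F j).
Proof.
move=> sH HF; rewrite big_seq; apply: (big_ind H) => //; first exact: sH.1.
by move=> x y; exact: subgroupD.
Qed.

Lemma subgroupMz H x (n : int) : subgroup H -> H x -> H (x *~ n).
Proof.
move=> sH Hx; have HM (m : nat) : H (x *+ m).
  by elim: m => [|m IHm]; rewrite ?mulr0n ?mulrS; [exact: sH.1|exact: subgroupD].
by case: n => m; [exact: HM | apply: subgroupN => //; exact: HM].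
Qed.

Lemma subgroup_set0 : subgroup [set (0 : A)].
Proof. by split=> // x y -> ->; rewrite /= subr0. Qed.

Lemma subgroup_smallest (B : set A) : subgroup (smallest subgroup B).
Proof.
split=> [H [[H0 _] _] //|x y Bx By H [sH BH]].
by apply: sH.2; [exact: Bx | exact: By].
Qed.

Definition addset H N := [set x + y | x in H & y in N].

Lemma subgroup_addset H N : subgroup H -> subgroup N -> subgroup (addset H N).
Proof.
move=> sH sN; split; first by exists 0; [exact: sH.1|exists 0; [exact: sN.1|rewrite addr0]].
move=> _ _ [h Hh [n Nn <-]] [h' Hh' [n' Nn' <-]].
exists (h - h'); first exact: sH.2.
by exists (n - n'); [exact: sN.2|rewrite opprD addrACA].
Qed.

Lemma sub_addsetl H N : N 0 -> H `<=` addset H N.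
Proof. by move=> N0 x Hx; exists x => //; exists 0; rewrite ?addr0. Qed.

Lemma sub_addsetr H N : H 0 -> N `<=` addset H N.
Proof. by move=> H0 x Nx; exists 0 => //; exists x; rewrite ?add0r. Qed.

Lemma addsetS H H' N : H `<=` H' -> addset H N `<=` addset H' N.
Proof. by move=> HH' _ [h /HH' H'h [n Nn <-]]; exists h => //; exists n. Qed.

End Subgroups.
Arguments subgroup {A} H.
Arguments subgroup_set0 {A}.
Hint Resolve subgroup_set0 : core.

Lemma subgroup_preimage (A A' : zmodType) (f : {additive A -> A'}) (H : set A') :
  subgroup H -> subgroup (f @^-1` H).
Proof.
by move=> sH; split=> [|x y Hx Hy]; rewrite /preimage /= ?raddf0 ?raddfB; [exact: sH.1|exact: sH.2].
Qed.

Section Lincomb.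
Variables (J : choiceType) (A : zmodType).
Implicit Types (b : J -> A) (D : {freeg J}).

Definition lincomb b D := \sum_(j <- dom D) b j *~ coeff j D.

Lemma lincomb_fglift b D : lincomb b D = fglift (b : J -> zmodule A) D.
Proof.
pose lift : {additive {freeg J} -> zmodule A} := HB.pack (fglift (b : J -> zmodule A))
  (GRing.isZmodMorphism.Build _ _ _ (lift_is_additive (b : J -> zmodule A))).
rewrite -[RHS]/(lift D) -{2}[D]freeg_sumE raddf_sum.
by apply: eq_bigr => j _; rewrite /= liftU scalezrE.
Qed.

Fact lincomb_is_zmod_morphism b : zmod_morphism (lincomb b).
Proof. by move=> D E; rewrite !lincomb_fglift lift_is_additive. Qed.

HB.instance Definition _ b := GRing.isZmodMorphism.Build {freeg J} A (lincomb b)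
  (lincomb_is_zmod_morphism b).

Lemma lincombU b n j : lincomb b << n *g j >> = b j *~ n.
Proof. by rewrite lincomb_fglift liftU scalezrE. Qed.

Lemma subgroup_lincomb (H : set A) b D : subgroup H -> {in dom D, forall j, H (b j)} ->
  H (lincomb b D).
Proof. by move=> sH Hb; apply: subgroup_sum => // j /Hb; exact: subgroupMz. Qed.

End Lincomb.

Lemma raddf_lincomb (J : choiceType) (A A' : zmodType) (f : {additive A -> A'})
    (b : J -> A) (D : {freeg J}) : f (lincomb b D) = lincomb (f \o b) D.
Proof. by rewrite /lincomb raddf_sum; apply: eq_bigr => j _; rewrite raddfMz. Qed.

Lemma lincomb_lincombU (I J : choiceType) (A : zmodType) (e : I -> J) (b : J -> A) D :
  lincomb b (lincomb (fun i => << e i >>) D) = lincomb (b \o e) D.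
Proof.
by rewrite raddf_lincomb; congr lincomb; apply/funext => i; rewrite /= lincombU mulr1z.
Qed.

Section FreegSupport.
Variable J : choiceType.
Implicit Types (B : set J) (D : {freeg J}).

Definition freeg_on B : set {freeg J} := [set D | [set` dom D] `<=` B].

Lemma subgroup_freeg_on B : subgroup (freeg_on B).
Proof.
split=> [j /=|D E DB EB j /=]; first by rewrite dom0.
by move=> /domB; rewrite mem_cat => /orP[/DB|/EB].
Qed.

Lemma freeg_onU B n j : B j -> freeg_on B << n *g j >>.
Proof.
move=> Bj i; have [->|n0] := eqVneq n 0; first by rewrite freegU0 /= dom0.
by rewrite /= domU // inE => /eqP ->.
Qed.

End FreegSupport.

Section Bases.
Variable A : zmodType.
Implicit Types N H : set A.

Record basis_mod (J : choiceType) N H (B : set J) (b : J -> A) : Prop := BasisMod {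
  basis_mem : forall j, B j -> H (b j);
  basis_span : forall x, H x -> exists2 D, freeg_on B D & N (x - lincomb b D);
  basis_indep : forall D, freeg_on B D -> N (lincomb b D) -> D = 0 }.

Lemma lincomb_basis_mem (J : choiceType) N H (B : set J) b D :
  subgroup H -> basis_mod N H B b -> freeg_on B D -> H (lincomb b D).
Proof. by move=> sH bB DB; apply: subgroup_lincomb => // j /DB /(basis_mem bB). Qed.

Lemma basis_inj (J : choiceType) N H (B : set J) b : N 0 -> basis_mod N H B b ->
  forall i j, B i -> B j -> b i = b j -> i = j.
Proof.
move=> N0 bB i j Bi Bj bij.
have /(basis_indep bB) : freeg_on B (<< i >> - << j >>).
  by apply: (subgroup_freeg_on _).2; exact: freeg_onU.
rewrite raddfB /= !lincombU bij subrr => /(_ N0) /(congr1 (coeff i)).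
by rewrite coeffB !coeffU eqxx coeff0; case: eqP.
Qed.

Lemma basis_mod_congr (J : choiceType) N H (B : set J) b b' : subgroup N ->
  (forall j, B j -> H (b' j) /\ N (b j - b' j)) -> basis_mod N H B b -> basis_mod N H B b'.
Proof.
move=> sN bb' bB; have ND D : freeg_on B D -> N (lincomb b D - lincomb b' D).
  move=> DB; rewrite /lincomb -sumrB; apply: subgroup_sum => // j /DB /bb' [_ Nbb'].
  by rewrite -mulrzBl; exact: subgroupMz.
split=> [j /bb' [] //|x /(basis_span bB) [D DB NxD]|D DB ND'].
- by exists D => //; rewrite -(subrK (lincomb b D) x) -addrA; apply: subgroupD => //; exact: ND.
- apply: (basis_indep bB DB); rewrite -(subrK (lincomb b' D) (lincomb b D)).
  by apply: subgroupD => //; exact: ND.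
Qed.

Lemma basis_mod_reindex (I J : choiceType) N H (B : set I) (e : I -> J) (b : J -> A) :
  (forall i i', B i -> B i' -> e i = e i' -> i = i') ->
  basis_mod N H B (b \o e) -> basis_mod N H (e @` B) b.
Proof.
move=> e_inj bB; split=> [_ [i Bi <-]|x /(basis_span bB) [D DB ND]|D DB ND].
- exact: basis_mem bB _ Bi.
- exists (lincomb (fun i => << e i >>) D); last by rewrite lincomb_lincombU.
  apply: subgroup_lincomb; first exact: subgroup_freeg_on.
  by move=> i /DB Bi; apply: freeg_onU; exists i.
have [g gP] : {g : J -> {freeg I} & forall j, (e @` B) j ->
    exists2 i, B i & e i = j /\ g j = << i >>}.
  apply: (@choice _ _ (fun j D => (e @` B) j -> exists2 i, B i & e i = j /\ D = << i >>)) => j.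
  have [[i Bi ij]|nBj] := pselect ((e @` B) j); last by exists 0.
  by exists << i >> => _; exists i.
have Dg j : j \in dom D -> exists2 i, B i & e i = j /\ g j = << i >> by move=> /DB /gP.
have DE : D = lincomb (fun i => << e i >>) (lincomb g D).
  rewrite -{1}[D]freeg_sumE raddf_lincomb; apply: eq_big_seq => j /Dg [i _ [<- /= ->]].
  by rewrite lincombU mulr1z freeg_mulz intz.
suff g0 : lincomb g D = 0 by rewrite DE g0 raddf0.
apply: (basis_indep bB); first by apply: subgroup_lincomb => [|j /Dg [i Bi [_ ->]]];
  [exact: subgroup_freeg_on|exact: freeg_onU].
by rewrite -lincomb_lincombU -DE.
Qed.

Lemma lincomb_inj (J : choiceType) H (B : set J) b D E : basis_mod [set 0] H B b ->
  freeg_on B D -> freeg_on B E -> lincomb b D = lincomb b E -> D = E.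
Proof.
move=> bB DB EB eqDE; apply/eqP; rewrite -subr_eq0; apply/eqP; apply: (basis_indep bB).
  exact: (subgroup_freeg_on B).2.
by rewrite raddfB /= eqDE subrr.
Qed.

Lemma basis_span0 (J : choiceType) H (B : set J) b x : basis_mod [set 0] H B b -> H x ->
  exists2 D, freeg_on B D & x = lincomb b D.
Proof.
by move=> bB /(basis_span bB) [D DB /= /eqP]; rewrite subr_eq0 => /eqP; exists D.
Qed.

Definition free_mod N H := exists B : set A, basis_mod N H B idfun.

Lemma basis_free_mod (J : choiceType) N H (B : set J) b : N 0 ->
  basis_mod N H B b -> free_mod N H.
Proof.
by move=> N0 bB; exists (b @` B); apply: basis_mod_reindex (bB); exact: basis_inj N0 bB.
Qed.

Lemma free_mod_sub N H : H `<=` N -> free_mod N H.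
Proof.
move=> HN; exists set0; split=> // [x Hx|D D0 _]; first exists 0.
- exact: (subgroup_freeg_on _).1.
- by rewrite raddf0 subr0; exact: HN.
apply/eqP; rewrite -dom_eq0; case sE: (dom D) => [//|j s].
by case: (D0 j); rewrite /= sE inE eqxx.
Qed.

End Bases.

Section QuotientIso.
Variables (A A' : zmodType) (f : {additive A -> A'}).
Variables (N H : set A) (N' H' : set A').

(* [f] induces an isomorphism from [H] modulo [N `&` H] onto [H' + N'] modulo [N']. *)
Record quotient_iso : Prop := QuotientIso {
  quotient_iso_mem : forall x, H x -> H' (f x);
  quotient_iso_ker : forall x, H x -> N' (f x) <-> N x;
  quotient_iso_surj : forall y, H' y -> exists2 x, H x & N' (y - f x) }.

Hypotheses (sH : subgroup H) (sN' : subgroup N') (f_iso : quotient_iso).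

Lemma basis_mod_image (J : choiceType) (B : set J) (b : J -> A) :
  basis_mod N H B b -> basis_mod N' H' B (f \o b).
Proof.
move=> bB; split=> [j Bj|y H'y|D DB ND].
- by apply: (quotient_iso_mem f_iso); exact: basis_mem bB _ Bj.
- have [x Hx N'x] := quotient_iso_surj f_iso H'y.
  have [D DB ND] := basis_span bB Hx; exists D => //.
  rewrite -raddf_lincomb -(subrK (f x) y) -addrA -raddfB; apply: subgroupD => //.
  by apply/(quotient_iso_ker f_iso) => //; apply: sH.2 => //; exact: lincomb_basis_mem bB DB.
- apply: (basis_indep bB DB); apply/(quotient_iso_ker f_iso); first exact: lincomb_basis_mem bB DB.
  by rewrite raddf_lincomb.
Qed.

Lemma basis_mod_preimage (J : choiceType) (B : set J) (b : J -> A) :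
  (forall j, B j -> H (b j)) -> basis_mod N' H' B (f \o b) -> basis_mod N H B b.
Proof.
move=> Hb bB.
have HD D : freeg_on B D -> H (lincomb b D).
  by move=> DB; apply: subgroup_lincomb => // j /DB /Hb.
split=> // [x Hx|D DB ND].
- have [D DB ND] := basis_span bB (quotient_iso_mem f_iso Hx); exists D => //.
  have HxD : H (x - lincomb b D) by apply: sH.2 => //; exact: HD.
  by apply/(quotient_iso_ker f_iso HxD); rewrite raddfB raddf_lincomb.
- apply: (basis_indep bB DB); rewrite -raddf_lincomb.
  by apply/(quotient_iso_ker f_iso) => //; exact: HD.
Qed.

Lemma free_mod_image : free_mod N H -> free_mod N' H'.
Proof. by case=> B /basis_mod_image /(basis_free_mod sN'.1). Qed.

End QuotientIso.

Lemma seq_argmax (d : Order.disp_t) (I : orderType d) (J : eqType) (ix : J -> I) (s : seq J) :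
  s != [::] -> exists2 k, k \in s & {in s, forall j, (ix j <= ix k)%O}.
Proof.
elim: s => [//|j s IHs] _; have [s0|/IHs [k ks k_max]] := eqVneq s [::].
  by exists j => [|i]; rewrite s0 inE // => /eqP ->.
have [jk|kj] := leP (ix j) (ix k).
  by exists k; rewrite ?inE ?ks ?orbT // => i; rewrite inE => /orP[/eqP ->|/k_max].
exists j; rewrite ?inE ?eqxx // => i; rewrite inE => /orP[/eqP -> //|/k_max ik].
exact: le_trans ik (ltW kj).
Qed.

Section Filtration.
Variables (A : zmodType) (d : Order.disp_t) (I : orderType d).
Hypothesis wfI : well_founded (fun i j : I => (i < j)%O).
Variables (N H : set A) (U L : I -> set A).

(* The stages are the [U i]; [L i] stands for the union of the stages before [i]. *)
Record filtration : Prop := Filtration {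
  filtration_sub : forall i, N `<=` L i;
  filtration_lower : forall i, subgroup (L i);
  filtration_lt : forall i j, (i < j)%O -> U i `<=` L j;
  filtration_pred : forall i,
    L i `<=` smallest subgroup (N `|` \bigcup_(j in [set j : I | (j < i)%O]) U j);
  filtration_mem : forall i, U i `<=` H;
  filtration_exhaust : H `<=` smallest subgroup (N `|` \bigcup_i U i) }.

Hypotheses (sN : subgroup N) (filHU : filtration).

(* In a linear relation modulo [N], the terms of largest index [i] would form a
   relation modulo [L i]. *)
Lemma basis_mod_filtration (J : choiceType) (ix : J -> I) (B : set J) (b : J -> A) :
  (forall i, basis_mod (L i) (U i) (B `&` ix @^-1` [set i]) b) -> basis_mod N H B b.
Proof.
move=> bas.
pose S := [set x | exists2 D, freeg_on B D & N (x - lincomb b D)].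
have sB := subgroup_freeg_on B.
have NS : N `<=` S.
  by move=> x Nx; exists 0; [exact: sB.1 | rewrite (raddf0 (lincomb b)) subr0].
have sS : subgroup S.
  split=> [|x y [D DB ND] [E EB NE]]; first by apply: NS; exact: sN.1.
  exists (D - E); first exact: sB.2.
  by rewrite raddfB opprD addrACA -opprD; apply: sN.2.
have US i : U i `<=` S.
  elim/(well_founded_ind wfI): i => i IH x /(basis_span (bas i)) [D DB LD].
  rewrite -(subrK (lincomb b D) x); apply: subgroupD => //.
    move: (x - _) LD => {DB}y /(filtration_pred filHU).
    by move: y; apply: smallest_sub => // y [/NS //|[j ji Uy]]; exact: IH ji _ Uy.
  by exists D; rewrite ?subrr; [move=> j /DB []|exact: sN.1].
split=> [j Bj|x /(filtration_exhaust filHU) Hx|D DB ND].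
- exact: filtration_mem filHU _ _ (basis_mem (bas (ix j)) (conj Bj erefl)).
- by move: x Hx; apply: smallest_sub => // y [/NS //|[i _ /US]].
apply/eqP; apply: contrapT => /negP; rewrite -dom_eq0 => /seq_argmax -/(_ _ _ ix) [k kD k_max].
pose top := fgmap [pred j | ix j == ix k] id D.
have top_coeff j : coeff j top = coeff j D *+ (ix j == ix k) by exact: fgmap_f0_coeffE.
suff : top = 0.
  move=> /(congr1 (coeff k)); rewrite top_coeff eqxx coeff0 => /eqP.
  by rewrite -[_ == _]negbK -mem_dom kD.
apply: (basis_indep (bas (ix k))).
  by move=> j /fgmap_dom; rewrite mem_filter => /andP[/eqP ? /DB].
have sL := filtration_lower filHU (ix k).
rewrite -[top](subKr D) raddfB; apply: sL.2; first exact: filtration_sub ND.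
apply: subgroup_lincomb => // j; rewrite mem_dom coeffB top_coeff.
have [|jk] := eqVneq (ix j) (ix k); rewrite ?subrr ?eqxx //= subr0 -mem_dom => jD.
have /(filtration_lt filHU) : (ix j < ix k)%O by rewrite lt_neqAle jk k_max.
by apply; exact: (basis_mem (bas (ix j)) (conj (DB j jD) erefl)).
Qed.

(* The family [b] lifts the bases [B i] of the graded pieces [Q i]. *)
Lemma basis_of_graded (A' : zmodType) (N' Q B : I -> set A') (r : I -> {additive A -> A'}) :
  (forall i, subgroup (U i)) -> (forall i, subgroup (N' i)) ->
  (forall i, quotient_iso (r i) (L i) (U i) (N' i) (Q i)) ->
  (forall i, basis_mod (N' i) (Q i) (B i) idfun) ->
  exists b : I * A' -> A, basis_mod N H [set k | B k.1 k.2] b.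
Proof.
move=> sU sN' r_iso bas.
have [b bP] : {b : I * A' -> A & forall k, B k.1 k.2 ->
    U k.1 (b k) /\ N' k.1 (k.2 - r k.1 (b k))}.
  apply: (@choice _ _ (fun k x => B k.1 k.2 -> U k.1 x /\ N' k.1 (k.2 - r k.1 x))) => -[i y].
  have [/= Biy|nBiy] := pselect (B i y); last by exists 0.
  by have [x Ux N'x] := quotient_iso_surj (r_iso i) (basis_mem (bas i) Biy); exists x.
exists b; apply: (basis_mod_filtration (ix := fst)) => i.
apply: (basis_mod_preimage (sU i) (r_iso i)); first by move=> k [/bP [Ub _] <-].
have -> : [set k | B k.1 k.2] `&` fst @^-1` [set i] = pair i @` B i.
  by apply/seteqP; split=> [[j y] [/= By ij]|_ [y By <-] //]; exists y; rewrite -?ij.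
apply: (basis_mod_congr (b := snd) (sN' i)) => [_ [y By <-]|].
  by have [Ub Nb] := bP (i, y) By; split=> //; exact: quotient_iso_mem (r_iso i) _ Ub.
by apply: basis_mod_reindex (bas i) => y y' _ _ [].
Qed.

Lemma free_mod_filtration : (forall i, subgroup (U i)) ->
  (forall i, free_mod (L i) (U i)) -> free_mod N H.
Proof.
move=> sU free; have sL := filtration_lower filHU.
have [B bas] := choice (free : forall i, exists B, basis_mod (L i) (U i) B idfun).
have [i|b] := basis_of_graded (r := fun=> idfun) sU sL _ bas.
  by split=> // x Ux; exists x => //; rewrite subrr; exact: (sL i).1.
exact: basis_free_mod sN.1.
Qed.

End Filtration.

Lemma free_mod_extension (A : zmodType) (N K H : set A) :
  subgroup N -> subgroup K -> subgroup H -> K `<=` H ->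
  free_mod N K -> free_mod (addset K N) H -> free_mod N H.
Proof.
move=> sN sK sH KH freeK freeH.
have wf_bool : well_founded (fun i j : bool => (i < j)%O).
  have acc_false : Acc (fun i j : bool => (i < j)%O) false by constructor => -[].
  by case; constructor => -[].
apply: (free_mod_filtration wf_bool (U := fun i => if i then H else K)
  (L := fun i => if i then addset K N else N)) => //; try by case.
split; try by case.
- by case=> //; exact: sub_addsetr sK.1.
- by case=> //; exact: subgroup_addset.
- by case=> -[] // _; exact: sub_addsetl sN.1.
- case=> x /=; last by move=> Nx; apply: sub_gen_smallest; left.
  move=> [k Kk [n Nn <-]]; apply: (subgroupD (subgroup_smallest _)).
    by apply: sub_gen_smallest; right; exists false.
  by apply: sub_gen_smallest; left.
- by move=> x Hx; apply: sub_gen_smallest; right; exists true.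
Qed.

Section BasisIso.
Variables (A A' : zmodType) (J : choiceType) (H : set A) (H' : set A').
Variables (B : set J) (b : J -> A) (b' : J -> A').

Lemma basis_set_iso : subgroup H -> subgroup H' ->
  basis_mod [set 0] H B b -> basis_mod [set 0] H' B b' ->
  exists phi : A -> A', set_iso H H' +%R +%R phi.
Proof.
move=> sH sH' bas bas'.
have [D DP] : {D : A -> {freeg J} & forall x, H x -> freeg_on B (D x) /\ x = lincomb b (D x)}.
  apply: (@choice _ _ (fun x D => H x -> freeg_on B D /\ x = lincomb b D)) => x.
  have [/(basis_span0 bas) [D DB ->]|nHx] := pselect (H x); last by exists 0.
  by exists D.
exists (lincomb b' \o D); split; first by move=> x /DP [DB _]; exact: lincomb_basis_mem bas' DB.
split; first by move=> x y /DP [DBx {2}->] /DP [DBy {2}->] /= /(lincomb_inj bas' DBx DBy) ->.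
split=> [z /(basis_span0 bas') [E EB ->]|x y Hx Hy /=].
  have HE := lincomb_basis_mem sH bas EB; have [DB /(lincomb_inj bas EB DB) DE] := DP _ HE.
  by exists (lincomb b E); rewrite /= -DE.
have [DBx xE] := DP x Hx; have [DBy yE] := DP y Hy.
have [DBxy xyE] := DP _ (subgroupD sH Hx Hy).
rewrite -raddfD; congr lincomb; apply: (lincomb_inj bas) => //.
  exact: subgroupD (subgroup_freeg_on B) DBx DBy.
by rewrite -xyE raddfD /= -xE -yE.
Qed.

End BasisIso.

Lemma List_InP (S : eqType) (x : S) (s : seq S) : reflect (List_In x s) (x \in s).
Proof.
elim: s => [|y s IHs]; first exact: ReflectF.
rewrite inE eq_sym; apply: (iffP orP) => -[].
- by move=> /eqP; left.
- by move=> /IHs; right.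
- by move=> ->; left.
- by move=> /IHs; right.
Qed.

Definition eval_at (T : Type) (A : zmodType) (x : T) (f : T -> A) := f x.

Fact eval_at_is_zmod_morphism (T : Type) (A : zmodType) (x : T) :
  zmod_morphism (@eval_at T A x).
Proof. by []. Qed.

HB.instance Definition _ (T : Type) (A : zmodType) (x : T) :=
  GRing.isZmodMorphism.Build (T -> A) A (eval_at x) (eval_at_is_zmod_morphism x).

Lemma fct_mulrzE (T : Type) (A : zmodType) (f : T -> A) (n : int) x : (f *~ n) x = f x *~ n.
Proof. by rewrite -[LHS]/(eval_at x _) raddfMz. Qed.

Section FinitelySupported.
Variables (J : choiceType) (B : set J).

Definition finitely_supported : set ({j | B j} -> int) :=
  [set c | exists s : seq {j | B j}, forall j, c j != 0 -> List_In j s].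

Lemma subgroup_finitely_supported : subgroup finitely_supported.
Proof.
split=> [|c e [s cs] [t et]]; first by exists [::] => j; rewrite eqxx.
exists (s ++ t) => j; rewrite -[(c - e) j]/(c j - e j) => cej; apply/List.in_app_iff.
have [cj|/cs] := eqVneq (c j) 0; [right|by left].
by apply: et; apply: contraNneq cej => ej; rewrite cj ej subrr.
Qed.

Definition unit_function (j : J) : {j | B j} -> int := fun i => (j == sval i)%:R.

Lemma lincomb_unit_function D i : lincomb unit_function D i = coeff (sval i) D.
Proof.
rewrite -[LHS]/(eval_at i _) raddf_lincomb -{2}[D]freeg_sumE raddf_sum.
by apply: eq_bigr => j _; rewrite /= coeffU /eval_at /unit_function -mulrzl intz.
Qed.

Lemma basis_unit_function : basis_mod [set 0] finitely_supported B unit_function.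
Proof.
split=> [j Bj|c [s cs]|D DB Dz].
- exists [:: exist _ j Bj] => -[i Bi]; rewrite /unit_function pnatr_eq0 eqb0 negbK.
  by move=> /eqP ji; left; exact: eq_exist.
- pose c' j := if pselect (B j) is left Bj then c (exist _ j Bj) else 0.
  have cE i : c' (sval i) = c i.
    by case: i => i Bi; rewrite /c' /=; case: pselect => // Bi'; congr c; exact: eq_exist.
  pose t := undup (map sval s).
  have tB : [set` t] `<=` B.
    move=> j /=; rewrite mem_undup => /List_InP /List.in_map_iff [[i Bi] [<- _]]; exact: Bi.
  exists (\sum_(j <- t) << c' j *g j >>).
    by apply: subgroup_sum; [exact: subgroup_freeg_on|move=> j /tB Bj; exact: freeg_onU].
  apply/eqP; rewrite subr_eq0; apply/eqP/funext => i; rewrite lincomb_unit_function raddf_sum /=.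
  under eq_bigr do rewrite coeffU.
  have [it|it] := boolP (sval i \in t).
    rewrite (bigD1_seq (sval i)) ?undup_uniq //= eqxx mulr1 cE big1 ?addr0 //.
    by move=> j /negbTE ->; rewrite mulr0.
  rewrite big_seq big1 => [|j jt]; last by case: eqP it => [<-|]; rewrite ?jt ?mulr0.
  apply/eqP; apply: contraNT it => /cs si; rewrite mem_undup.
  by apply/List_InP/List.in_map_iff; exists i.
- apply/eqP/freeg_eqP => j; rewrite coeff0; apply/eqP; apply: contrapT => /negP.
  rewrite -mem_dom => jD; have Bj := DB j jD.
  move: jD; rewrite mem_dom -[j]/(sval (exist _ j Bj)) -lincomb_unit_function Dz.
  by rewrite eqxx.
Qed.

End FinitelySupported.

Lemma basis_free_abelian (A : zmodType) (J : choiceType) (H : set A) (B : set J) (b : J -> A) :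
  subgroup H -> basis_mod [set 0] H B b -> free_abelian H +%R.
Proof.
move=> sH bas; have [phi phi_iso] := basis_set_iso sH (@subgroup_finitely_supported _ B) bas
  (@basis_unit_function _ B).
by exists {j | B j}, phi.
Qed.

Lemma set_iso_comp (T1 T2 T3 : Type) (G1 : set T1) (G2 : set T2) (G3 : set T3) op1 op2 op3
    (phi : T1 -> T2) (psi : T2 -> T3) :
  set_iso G1 G2 op1 op2 phi -> set_iso G2 G3 op2 op3 psi -> set_iso G1 G3 op1 op3 (psi \o phi).
Proof.
move=> [phiG [phi_inj [phi_surj phiM]]] [psiG [psi_inj [psi_surj psiM]]]; split.
  by move=> x /phiG /psiG.
split; first by move=> x y Gx Gy /= /psi_inj /phi_inj; apply; rewrite ?Gx ?Gy //; exact: phiG.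
split=> [z /psi_surj [y [/phi_surj [x [Gx <-]] <-]]|x y Gx Gy /=]; first by exists x.
by rewrite phiM // psiM //; exact: phiG.
Qed.

Lemma free_abelian_iso (T1 T2 : Type) (G1 : set T1) (G2 : set T2) op1 op2 (phi : T1 -> T2) :
  set_iso G1 G2 op1 op2 phi -> free_abelian G2 op2 -> free_abelian G1 op1.
Proof.
move=> phi_iso [B [psi psi_iso]]; exists B, (psi \o phi).
exact: set_iso_comp psi_iso.
Qed.

(** * Simple functions and Nobeling's theorem *)

Section Indicators.
Variable T : Type.
Implicit Types (U V : set T) (f g : T -> int).

Definition indicator U : T -> int := fun x => (`[< U x >])%:R.

Lemma indicator_in U x : U x -> indicator U x = 1.
Proof. by move=> Ux; rewrite /indicator asboolT. Qed.

Lemma indicator_notin U x : ~ U x -> indicator U x = 0.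
Proof. by move=> nUx; rewrite /indicator asboolF. Qed.

Lemma indicatorT : indicator setT = 1.
Proof. by apply/funext => x; exact: indicator_in. Qed.

Lemma indicator0 : indicator set0 = 0.
Proof. by apply/funext => x; exact: indicator_notin. Qed.

Lemma indicatorI U V : indicator (U `&` V) = indicator U * indicator V.
Proof. by apply/funext => x; rewrite /indicator asbool_and -mulnb natrM. Qed.

Lemma indicatorD U V : indicator (U `\` V) = indicator U - indicator (U `&` V).
Proof.
apply/funext => x; rewrite /indicator -[RHS]/(_%:R - _%:R) !asbool_and asbool_neg.
by case: `[< U x >]; case: `[< V x >].
Qed.

Lemma indicatorU U V : indicator (U `|` V) = indicator U + indicator (V `\` U).
Proof.
apply/funext => x; rewrite /indicator -[RHS]/(_%:R + _%:R) asbool_or asbool_and asbool_neg.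
by case: `[< U x >]; case: `[< V x >].
Qed.

Lemma mul_indicator_idem U f : f * indicator U * indicator U = f * indicator U.
Proof. by rewrite -mulrA -indicatorI setIid. Qed.

Section IndicatorSets.
Variable Q : set (T -> int).
Hypotheses (sQ : subgroup Q)
  (QI : forall U V, Q (indicator U) -> Q (indicator V) -> Q (indicator (U `&` V))).

Lemma indicator_mem0 : Q (indicator set0).
Proof. by rewrite indicator0; exact: sQ.1. Qed.

Lemma indicator_memD U V : Q (indicator U) -> Q (indicator V) -> Q (indicator (U `\` V)).
Proof. by move=> QU QV; rewrite indicatorD; apply: sQ.2 => //; exact: QI. Qed.

Lemma indicator_memU U V : Q (indicator U) -> Q (indicator V) -> Q (indicator (U `|` V)).
Proof. by move=> QU QV; rewrite indicatorU; apply: subgroupD => //; exact: indicator_memD. Qed.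

End IndicatorSets.

Record indicator_spanned (Q : set (T -> int)) : Prop := IndicatorSpanned {
  indicator_spanned_subgroup : subgroup Q;
  indicator_spannedI : forall U V,
    Q (indicator U) -> Q (indicator V) -> Q (indicator (U `&` V));
  indicator_spanned_sub :
    Q `<=` smallest subgroup (indicator @` [set U | Q (indicator U)]) }.

Lemma subgroup_mulr_preimage (H : set (T -> int)) f : subgroup H ->
  subgroup [set g | H (g * f)].
Proof. exact: (@subgroup_preimage _ _ (f \o* idfun)). Qed.

Lemma indicator_spannedM Q f g : indicator_spanned Q -> Q f -> Q g -> Q (f * g).
Proof.
move=> [sQ QI Qspan] Qf; rewrite mulrC; move: g => g /Qspan; move: g.
apply: smallest_sub; first exact: subgroup_mulr_preimage.
move=> _ [U QU <-] /=; move: Qf => /Qspan; rewrite mulrC; move: f.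
apply: smallest_sub; first exact: subgroup_mulr_preimage.
by move=> _ [V QV <-]; rewrite /= -indicatorI; exact: QI.
Qed.

End Indicators.
Arguments indicator {T} U _.

Section SimpleFunctions.
Variable T : Type.
Implicit Types (E J : set (set T)) (U V : set T) (f g : T -> int).

Definition subring_of (A : pzRingType) (S : set A) :=
  [/\ S 1, subgroup S & forall x y, S x -> S y -> S (x * y)].

Definition simple E : set (T -> int) :=
  smallest (@subring_of (T -> int)) (indicator @` E).

Lemma subring_simple E : subring_of (simple E).
Proof.
split=> [S [[S1 _ _] _] //| |f g Ef Eg S SE]; last first.
  by have [[_ _ SM] _] := SE; apply: SM; [exact: Ef|exact: Eg].
split=> [S [[_ [S0 _] _] _] //|f g Ef Eg S SE].
by have [[_ [_ SB] _] _] := SE; apply: SB; [exact: Ef|exact: Eg].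
Qed.

Lemma simple1 E : simple E 1. Proof. by case: (subring_simple E). Qed.

Lemma subgroup_simple E : subgroup (simple E). Proof. by case: (subring_simple E). Qed.

Lemma simpleM E f g : simple E f -> simple E g -> simple E (f * g).
Proof. by case: (subring_simple E) => _ _; apply. Qed.

Lemma simple_indicator E U : E U -> simple E (indicator U).
Proof. by move=> EU; apply: sub_gen_smallest; exists U. Qed.

Lemma simpleS E E' : E `<=` E' -> simple E `<=` simple E'.
Proof.
move=> EE'; apply: sub_smallest2r; first exact: subring_simple.
exact: image_subset.
Qed.

Let simpleI E U V : simple E (indicator U) -> simple E (indicator V) ->
  simple E (indicator (U `&` V)).
Proof. by rewrite indicatorI; exact: simpleM. Qed.

Let finite_simple E f := (exists s : seq int, forall x, f x \in s) /\
  forall A, simple E (indicator (f @^-1` A)).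

Let finite_simple_op E (op : int -> int -> int) f g : finite_simple E f ->
  finite_simple E g -> finite_simple E (fun x => op (f x) (g x)).
Proof.
move=> [[s fs] fE] [[t gt] gE]; split.
  exists [seq op a b | a <- s, b <- t] => x.
  by apply/allpairsP; exists (f x, g x); split; [exact: fs|exact: gt|].
move=> A; have -> : (fun x => op (f x) (g x)) @^-1` A =
    \big[setU/set0]_(a <- s) (f @^-1` [set a] `&` g @^-1` [set b | A (op a b)]).
  rewrite -bigcup_seq; apply/seteqP; split=> x /=; first by exists (f x) => //; exact: fs.
  by move=> [a _ [/= ->]].
apply: (big_ind (fun U => simple E (indicator U))) => [|U V|a _].
- exact: indicator_mem0 (subgroup_simple E).
- exact: (indicator_memU (subgroup_simple E) (@simpleI E)).
- exact: simpleI.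
Qed.

Let simple_const_set (E : set (set T)) (P : Prop) : simple E (indicator [set _ | P]).
Proof.
have [HP|nP] := pselect P.
  have -> : [set _ | P] = setT :> set T by apply/seteqP; split.
  by rewrite indicatorT; exact: simple1.
have -> : [set _ | P] = set0 :> set T by apply/seteqP; split.
exact: indicator_mem0 (subgroup_simple E).
Qed.

Lemma simple_preimage E f (A : set int) : simple E f -> simple E (indicator (f @^-1` A)).
Proof.
suff sub : simple E `<=` finite_simple E by move=> /sub [_].
apply: smallest_sub => [|_ [U EU <-]].
  split.
  - by split=> [|A']; [exists [:: 1] => x; rewrite inE|exact: (@simple_const_set E (A' 1))].
  - split=> [|f' g]; last exact: (@finite_simple_op E (fun a b => a - b)).
    by split=> [|A']; [exists [:: 0] => x; rewrite inE|exact: (@simple_const_set E (A' 0))].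
  - by move=> f' g; exact: (@finite_simple_op E (fun a b => a * b)).
split=> [|A']; first by exists [:: 0; 1] => x; rewrite /indicator; case: asboolP.
have -> : indicator U @^-1` A' = (U `&` [set _ | A' 1]) `|` ([set _ | A' 0] `\` U).
  apply/seteqP; split=> x /=; rewrite /indicator.
    by case: asboolP => Ux A'x; [left|right].
  by case: asboolP => Ux [[]|[]].
have EU' := simple_indicator EU; have sE := subgroup_simple E.
apply: (indicator_memU sE (@simpleI E)); first exact: simpleI.
by apply: (indicator_memD sE (@simpleI E)).
Qed.

Lemma simple_adjoin E V f : simple (E `|` [set V]) f ->
  exists a b, [/\ simple E a, simple E b & f = b + a * indicator V].
Proof.
have sE := subgroup_simple E; have E0 := sE.1; have E1 : simple E 1 by exact: simple1.
apply: (@smallest_sub _ _ _ [set f : T -> int | exists a b, [/\ simple E a, simple E b &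
  f = b + a * indicator V]]).
  split; first by exists 0, 1; split=> //; rewrite mul0r addr0.
    split=> [|_ _ [a [b [Ea Eb ->]]] [a' [b' [Ea' Eb' ->]]]].
      by exists 0, 0; split=> //; rewrite mul0r addr0.
    exists (a - a'), (b - b'); split; [exact: sE.2|exact: sE.2|].
    by rewrite mulrBl opprD addrACA.
  move=> _ _ [a [b [Ea Eb ->]]] [a' [b' [Ea' Eb' ->]]].
  exists (a * b' + b * a' + a * a'), (b * b'); split; last first.
  - rewrite mulrDl !mulrDr !mulrA addrA; rewrite [a * _ * a']mulrAC -mulrA.
    rewrite [_ * (_ * _)]mulrA mul_indicator_idem !mulrDl.
    by rewrite [a * _ * b']mulrAC !addrA [_ + b * a' * _ + _]addrAC.
  - exact: simpleM.
  - by do 2?[apply: (subgroupD sE)]; exact: simpleM.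
move=> _ [U [EU|->] <-]; last by exists 1, 0; split=> //; rewrite mul1r add0r.
by exists 0, (indicator U); split=> //; [exact: simple_indicator|rewrite mul0r addr0].
Qed.

Lemma simple_set0 f : simple set0 f <-> exists n : int, f = 1 *~ n.
Proof.
split=> [|[n ->]]; last by exact: (subgroupMz n (@subgroup_simple set0) (@simple1 set0)).
apply: (@smallest_sub _ _ _ [set f : T -> int | exists n : int, f = 1 *~ n]).
  2: by move=> _ [U []].
split; first by exists 1; rewrite mulr1z.
  split=> [|_ _ [m ->] [n ->]]; first by exists 0; rewrite mulr0z.
  by exists (m - n); rewrite mulrzBr.
by move=> _ _ [m ->] [n ->]; exists (m * n); rewrite mulrzAl mul1r mulrzA_C.
Qed.

Definition set_ideal J :=
  [/\ J set0, forall U V, J U -> J V -> J (U `|` V) & forall U V, U `<=` V -> J V -> J U].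

Definition null J : set (T -> int) := [set f | J [set x | f x != 0]].

Lemma subgroup_null J : set_ideal J -> subgroup (null J).
Proof.
move=> [J0 JU JS]; split=> [|f g Jf Jg]; first by apply: JS J0 => x /eqP [].
apply: JS (JU _ _ Jf Jg) => x /=; rewrite -[(f - g) x]/(f x - g x).
by have [->|] := eqVneq (f x) 0; [rewrite sub0r oppr_eq0; right|left].
Qed.

Lemma null_mulr J f g : set_ideal J -> null J f -> null J (g * f).
Proof.
by case=> _ _ JS; apply: JS => x /=; rewrite -[(g * f) x]/(g x * f x) mulf_eq0 negb_or => /andP[].
Qed.

(* Modulo [null J], adjoining [V] to [E] enlarges [simple E] by a quotient
   isomorphic to [simple E] modulo [null (trace_ideal E J V)]. *)
Definition trace_ideal E J V : set (set T) := [set W | exists a, [/\ simple E a,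
  addset (simple E) (null J) (a * indicator V) & W `<=` [set x | a x != 0]]].

Lemma set_ideal_trace E J V : set_ideal J -> set_ideal (trace_ideal E J V).
Proof.
move=> idJ; have sM := subgroup_addset (@subgroup_simple E) (subgroup_null idJ).
split=> [|W W' [a [Ea aM Wa]] [a' [Ea' aM' Wa']]|W W' sW [a [Ea aM Wa]]].
- exists 0; split; [exact: (@subgroup_simple E).1|rewrite mul0r; exact: sM.1|exact: sub0set].
- have mulM b f : simple E b -> addset (simple E) (null J) f -> addset (simple E) (null J) (b * f).
    move=> Eb [g Eg [n Jn <-]]; exists (b * g); first exact: simpleM.
    by exists (b * n); [exact: null_mulr|rewrite mulrDr].
  exists (a * a + a' * a'); split.
  + by apply: (subgroupD (@subgroup_simple E)); exact: simpleM.
  + by rewrite mulrDl -!mulrA; apply: (subgroupD sM); exact: mulM.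
  + move=> x [/Wa|/Wa'] /=; rewrite -[(_ + _) x]/(a x * a x + a' x * a' x); nia.
- by exists a; split=> //; exact: subset_trans Wa.
Qed.

Lemma trace_idealP E J V b : set_ideal J -> simple E b ->
  addset (simple E) (null J) (b * indicator V) <-> null (trace_ideal E J V) b.
Proof.
move=> idJ Eb; split=> [bM|[a [Ea [g Eg [n Jn e]] ba]]]; first by exists b; split.
pose supp f := indicator (f @^-1` [set m | m != 0]).
exists (b * supp g); first by apply: simpleM => //; exact: simple_preimage.
exists (b * indicator V - b * supp g); last by rewrite addrC subrK.
have [_ _ JS] := idJ; apply: JS Jn => x /=.
rewrite -[(_ - _) x]/(b x * indicator V x - b x * indicator _ x) => bx.
apply: contraNneq bx => nx; have /= := congr1 (fun f : T -> int => f x) e.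
rewrite -[(g + n) x]/(g x + n x) -[(a * _) x]/(a x * indicator V x) nx addr0.
rewrite -mulrBr mulf_eq0; have [//|/ba /= ax] := eqVneq (b x) 0.
rewrite /indicator /preimage; case: (pselect (V x)) => [Vx|nVx].
  by rewrite [`[< V x >]]asboolT // mulr1 /= => ->; rewrite asboolT.
by rewrite [`[< V x >]]asboolF // mulr0 /= => ->; rewrite asboolF //= eqxx.
Qed.

Lemma free_mod_adjoin E J V : set_ideal J ->
  (forall J', set_ideal J' -> free_mod (null J') (simple E)) ->
  free_mod (addset (simple E) (null J)) (simple (E `|` [set V])).
Proof.
move=> idJ freeE; have sM := subgroup_addset (@subgroup_simple E) (subgroup_null idJ).
apply: (free_mod_image (f := indicator V \o* idfun)) (freeE _ (set_ideal_trace E V idJ)) => //.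
  exact: subgroup_simple.
split=> [b Eb|b Eb|f /simple_adjoin [a [b [Ea Eb ->]]]]; last first.
- by exists a; rewrite //= addrK; exact: sub_addsetl (subgroup_null idJ).1 _ Eb.
- exact: trace_idealP.
- by apply: simpleM; [apply: simpleS Eb; exact: subsetUl|apply: simple_indicator; right].
Qed.

Lemma free_mod_constants J : set_ideal J -> free_mod (null J) (simple set0).
Proof.
move=> idJ; have [J0 JU JS] := idJ; have sJ := subgroup_null idJ.
apply: (@basis_free_mod _ unit _ _ [set _ | ~ J setT] (fun=> 1)) => //; first exact: sJ.1.
split=> [_ _|f /simple_set0 [n ->]|D DJ JD]; first exact: simple1.
- have [JT|nJT] := pselect (J setT).
    by exists 0; [exact: (subgroup_freeg_on _).1|apply: JS JT].
  exists << n *g tt >>; first exact: freeg_onU.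
  by rewrite lincombU subrr; exact: sJ.1.
- have DE : D = << coeff tt D *g tt >> by apply/eqP/freeg_eqP => -[]; rewrite coeffU mulr1.
  have [n0|n0] := eqVneq (coeff tt D) 0; first by rewrite DE n0 freegU0.
  have /DJ [] : tt \in dom D by rewrite mem_dom.
  by apply: JS JD => x _ /=; rewrite DE lincombU fct_mulrzE intz.
Qed.

End SimpleFunctions.

Lemma well_ordered_enum (S : Type) (A : set S) :
  exists (d : Order.disp_t) (I : orderType d) (e : I -> S),
    well_founded (fun i j : I => (i < j)%O) /\ range e = A.
Proof.
pose W : choiceType := {classic {x : S | A x}}.
have [R woR] := well_ordering_principle W.
have woC : wo_chain R predT by exact: withinW.
have R_total : total R by move=> x y; exact: (wo_chainW woC).
have R_refl : reflexive R by move=> x; have /orP[] := R_total x x.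
have R_anti : antisymmetric R by move=> x y; exact: (wo_chain_antisymmetric woC).
have R_min (P : set W) x : P x -> exists2 m, P m & forall y, P y -> R m y.
  move=> Px; have [|m [[/asboolP Pm m_min] _]] := woR [pred z | `[< P z >]].
    by exists x; exact/asboolP.
  by exists m => // y Py; apply: m_min; exact/asboolP.
have R_trans : transitive R.
  move=> y x z Rxy Ryz.
  have [m mP m_min] := R_min [set w | [\/ w = x, w = y | w = z]] x (Or31 _ _ erefl).
  have mx := m_min x (Or31 _ _ erefl).
  have my := m_min y (Or32 _ _ erefl).
  have mz := m_min z (Or33 _ _ erefl).
  case: mP => mE; rewrite mE in mx my mz => //.
    by rewrite (R_anti x y) // Rxy mx.
  by rewrite -(R_anti y z) // Ryz my.
pose d := Order.Disp tt tt.
pose P : porderType d := HB.pack W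
  (Order.Le_isPOrder.Build d W R_refl R_anti R_trans).
pose I : orderType d := HB.pack P
  (Order.POrder_isTotal.Build d P R_total).
exists d, I, sval; split.
  move=> x; apply: contrapT => nx.
  have [m nm m_min] := R_min [set x | ~ Acc (fun i j : I => (i < j)%O) x] x nx.
  apply: nm; constructor => y /lt_geF ym; apply: contrapT => /m_min my.
  by rewrite [(_ <= _)%O]my in ym.
by apply/seteqP; split=> [_ [[x Ax] _ <-] //|x Ax]; exists (exist _ x Ax).
Qed.

Section WellOrderedSimple.
Variables (T : Type) (d : Order.disp_t) (I : orderType d) (E : I -> set T).
Hypothesis wfI : well_founded (fun i j : I => (i < j)%O).
Implicit Types (D : set I) (J : set (set T)).

Let below D i := E @` (D `&` [set j | (j < i)%O]).
Let upto D i := E @` (D `&` [set j | (j <= i)%O]).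

Lemma simple_upto D f : simple (E @` D) f ->
  simple set0 f \/ exists2 i, D i & simple (upto D i) f.
Proof.
have upto_le i j : (i <= j)%O -> simple (upto D i) `<=` simple (upto D j).
  by move=> ij; apply: simpleS; apply: image_subset => k [Dk ki]; split=> //; exact: le_trans ki ij.
have upto0 i : simple set0 `<=` simple (upto D i) by apply: simpleS.
have upto_op (op : (T -> int) -> (T -> int) -> T -> int) :
    (forall F f' g, simple F f' -> simple F g -> simple F (op f' g)) ->
    forall f' g, simple set0 f' \/ (exists2 i, D i & simple (upto D i) f') ->
    simple set0 g \/ (exists2 i, D i & simple (upto D i) g) ->
    simple set0 (op f' g) \/ exists2 i, D i & simple (upto D i) (op f' g).
  move=> opP f' g [f0|[i Di fi]] [g0|[j Dj gj]].
  - by left; exact: opP.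
  - by right; exists j => //; apply: opP => //; exact: upto0.
  - by right; exists i => //; apply: opP => //; exact: upto0.
  - right; have [ij|/ltW ji] := leP i j.
      by exists j => //; apply: opP => //; exact: upto_le fi.
    by exists i => //; apply: opP => //; exact: upto_le gj.
apply: (@smallest_sub _ _ _ [set f : T -> int |
  simple set0 f \/ exists2 i, D i & simple (upto D i) f]) => [|_ [_ [i Di <-] <-]].
  split; [by left; exact: simple1|split|].
  - by left; exact: (@subgroup_simple _ set0).1.
  - by apply: (upto_op (fun f g => f - g)) => F; exact: (@subgroup_simple _ F).2.
  - by apply: (upto_op (fun f g => f * g)) => F f' g; exact: simpleM.
by right; exists i => //; apply: simple_indicator; exists i => //; split=> //=.
Qed.

Lemma free_mod_simple_over_constants D J : set_ideal J ->
  (forall i J', D i -> set_ideal J' -> free_mod (null J') (simple (below D i))) ->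
  free_mod (addset (simple set0) (null J)) (simple (E @` D)).
Proof.
move=> idJ free_below; have sJ := subgroup_null idJ.
have sE (F : set (set T)) : subgroup (simple F) by exact: subgroup_simple.
have sN : subgroup (addset (simple set0) (null J)) by exact: subgroup_addset.
apply: (free_mod_filtration wfI (U := fun i => simple (upto D i))
  (L := fun i => addset (simple (below D i)) (null J))) => // [|i].
  split=> [i|i|i j ij f fi|i|i|f].
  - by apply: addsetS; exact: simpleS.
  - exact: subgroup_addset.
  - apply: (sub_addsetl sJ.1); apply: simpleS fi => _ [k [Dk ki] <-].
    by exists k => //; split=> //; exact: le_lt_trans ki ij.
  - move=> _ [f /simple_upto f_upto [n Jn <-]]; apply: (subgroupD (subgroup_smallest _)).
      case: f_upto => [f0|[j [Dj ji] fj]]; apply: sub_gen_smallest.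
        by left; exact: (sub_addsetl sJ.1).
      right; exists j => //; apply: simpleS fj; apply: image_subset => k [[]]; by split.
    by apply: sub_gen_smallest; left; exact: (sub_addsetr (sE _).1).
  - by apply: simpleS; apply: image_subset => k [].
  - move=> /simple_upto [f0|[i Di fi]]; apply: sub_gen_smallest.
      by left; exact: (sub_addsetl sJ.1).
    by right; exists i.
have [Di|nDi] := pselect (D i).
  have -> : upto D i = below D i `|` [set E i].
    rewrite -image_set1 -image_setU; congr image; apply/seteqP; split=> j /=.
      by move=> [Dj]; rewrite le_eqVlt => /orP[/eqP ->|ji]; [right|left].
    by move=> [[Dj /ltW]|->].
  by apply: free_mod_adjoin => // J'; exact: free_below.
apply: free_mod_sub; apply: subset_trans (sub_addsetl sJ.1); apply: simpleS; apply: image_subset.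
by move=> j [Dj ji]; split=> //=; rewrite lt_neqAle ji andbT; apply: contra_notN nDi => /eqP <-.
Qed.

Lemma free_mod_simple_below i D J : set_ideal J -> free_mod (null J) (simple (below D i)).
Proof.
elim/(well_founded_ind wfI): i D J => i IH D J idJ; have sJ := subgroup_null idJ.
have s0 : subgroup (simple (set0 : set (set T))) by exact: subgroup_simple.
apply: (free_mod_extension sJ s0).
- exact: subgroup_simple.
- exact: simpleS.
- exact: free_mod_constants.
by apply: free_mod_simple_over_constants => // j J' [_ ji]; exact: IH.
Qed.

End WellOrderedSimple.

Section Pointing.
Variable T : Type.

Definition extend0 (y : T -> int) (o : option T) : int := if o is Some x then y x else 0.

Definition vanish_at_None (h : option T -> int) : T -> int := fun x => h (Some x) - h None.

Fact extend0_is_zmod_morphism : zmod_morphism extend0.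
Proof. by move=> f g; apply/funext; case. Qed.

Fact vanish_at_None_is_zmod_morphism : zmod_morphism vanish_at_None.
Proof.
move=> g h; apply/funext => x.
by rewrite -[LHS]/(_ - _ - (_ - _)) -[RHS]/(_ - _ - (_ - _)); ring.
Qed.

HB.instance Definition _ := GRing.isZmodMorphism.Build (T -> int) (option T -> int)
  extend0 extend0_is_zmod_morphism.

HB.instance Definition _ := GRing.isZmodMorphism.Build (option T -> int) (T -> int)
  vanish_at_None vanish_at_None_is_zmod_morphism.

Lemma extend0K : cancel extend0 vanish_at_None.
Proof. by move=> y; apply/funext => x; exact: subr0. Qed.

Lemma vanish_at_None1 : vanish_at_None 1 = 0.
Proof. by apply/funext => x; exact: subrr. Qed.

Lemma vanish_at_NoneM g h : vanish_at_None (g * h) =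
  vanish_at_None g * vanish_at_None h + vanish_at_None g *~ h None + vanish_at_None h *~ g None.
Proof.
apply/funext => x.
rewrite !addrfctE mulrfctE /= !fct_mulrzE !mulrzz /vanish_at_None mulrfctE; ring.
Qed.

Lemma vanish_at_None_eq0 h : vanish_at_None h = 0 -> h = 1 *~ h None.
Proof.
move=> h0; apply/funext => o; rewrite fct_mulrzE intz; case: o => // x.
by apply/eqP; rewrite -subr_eq0 -[_ - _]/(vanish_at_None h x) h0.
Qed.

Lemma extend0_indicator U : extend0 (indicator U) = indicator (Some @` U).
Proof.
apply/funext => -[x|]; last by rewrite indicator_notin //; case.
by congr (nat_of_bool _)%:R; apply: asbool_equiv_eq; split=> [Ux|[_ Ux [<-]] //]; exists x.
Qed.

End Pointing.

(* Functions on [T] become functions on [option T] vanishing at [None], of which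
   the constants are a complement. *)
Theorem free_mod_indicator_spanned (T : Type) (Q : set (T -> int)) :
  indicator_spanned Q -> free_mod [set 0] Q.
Proof.
move=> spanQ; have [sQ QI Qspan] := spanQ.
have [d [I [E [wfI EE]]]] :=
  well_ordered_enum ((fun U => Some @` U) @` [set U | Q (indicator U)]).
have id0 : set_ideal [set (set0 : set (option T))].
  split=> // [U V -> ->|U V UV e]; first by rewrite /= setU0.
  by rewrite /= -subset0 -e.
have null0 f : null [set set0] f -> f = 0.
  move=> f0; apply/funext => x; apply: contrapT => /eqP fx.
  by have : [set x | f x != 0] x := fx; rewrite f0.
have free : free_mod (addset (simple set0) (null [set set0])) (simple (range E)).
  by apply: (free_mod_simple_over_constants wfI) => // i J _; exact: free_mod_simple_below.
apply: (free_mod_image (f := @vanish_at_None T)) free => //; first exact: subgroup_simple.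
split=> [h|h _|y Qy].
- apply: (@smallest_sub _ _ _ (@vanish_at_None T @^-1` Q)) => [|_ [U + <-]].
    split=> [||g h' Qg Qh]; [|exact: subgroup_preimage|].
      by suff : Q (vanish_at_None 1) by []; rewrite vanish_at_None1; exact: sQ.1.
    rewrite /preimage /= vanish_at_NoneM; apply: (subgroupD sQ); last exact: subgroupMz.
    by apply: (subgroupD sQ); [exact: indicator_spannedM|exact: subgroupMz].
  by rewrite EE => -[V QV <-]; rewrite /preimage /= -extend0_indicator extend0K.
- split=> [/vanish_at_None_eq0 hE|[g /simple_set0 [n ->] [h' /null0 -> <-]]].
    by apply: (sub_addsetl (subgroup_null id0).1); apply/simple_set0; exists (h None).
  by rewrite addr0 raddfMz /= vanish_at_None1 mul0rz.
- exists (extend0 y); last by rewrite /= extend0K; exact: subrr.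
  move: y Qy => y /Qspan; apply: (@smallest_sub _ _ _ (@extend0 T @^-1` simple (range E))).
    by apply: subgroup_preimage; exact: subgroup_simple.
  move=> _ [U QU <-]; rewrite /preimage /= extend0_indicator.
  by apply: simple_indicator; rewrite EE; exists U.
Qed.

(** * Compact lattice-ordered groups of functions *)

Lemma set_ideal_finite_cover (T : Type) (J : set (set T)) (s : seq (set T)) : set_ideal J ->
  (forall U, List_In U s -> J U) -> J [set x | exists U, List_In U s /\ U x].
Proof.
move=> [J0 JU JS]; elim: s => [|U s IHs] sJ; first by apply: JS J0 => x [U []].
apply: JS (JU _ _ (sJ U (or_introl erefl)) (IHs _)) => [x [V [[<-|sV] Vx]]|V sV].
- by left.
- by right; exists V.
- by apply: sJ; right.
Qed.

(* Compactness as an induction principle over ideals of sets. *)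
Lemma compact_inP (T : Type) (op : set (set T)) (A : set T) :
  compact_in op A <-> forall J, set_ideal J ->
    (forall x, A x -> exists U, [/\ op U, U x & J U]) -> J A.
Proof.
split=> [cA J idJ locJ|indA F Fop AF].
  have [|x /locJ [U [opU Ux JU]]|s [sJ As]] := cA [set U | op U /\ J U].
  - by move=> U [].
  - by exists U.
  by have [_ _ JS] := idJ; apply: JS As _; apply: set_ideal_finite_cover => // U /sJ [].
apply: (indA [set W | exists s : seq (set T), (forall U, List_In U s -> F U) /\
    W `<=` [set x | exists U, List_In U s /\ U x]]).
  split=> [|W W' [s [sF Ws]] [s' [sF' Ws']]|W W' WW' [s [sF Ws]]].
  - by exists [::]; split=> // x [].
  - exists (s ++ s'); split=> [U /List.in_app_iff [/sF|/sF'] //|].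
    by move=> x [/Ws|/Ws'] [U [sU Ux]]; exists U; split=> //; apply/List.in_app_iff; [left|right].
  - by exists s; split=> //; exact: subset_trans Ws.
move=> x /AF [U [FU Ux]]; exists U; split=> //; first exact: Fop.
by exists [:: U]; split=> [V [<-|]|y Uy] //; exists U; split=> //; left.
Qed.

Section CompactLGroup.
Variable T : Type.
Implicit Types (X C D U V W : set T) (G : set (T -> int)) (g h f : T -> int).

Lemma min_closed_max G : subgroup G -> (forall g h, G g -> G h -> G (g \min h)) ->
  forall g h, G g -> G h -> G (g \max h).
Proof.
move=> sG Gmin g h Gg Gh; have := subgroupN sG (Gmin _ _ (subgroupN sG Gg) (subgroupN sG Gh)).
by congr G; apply/funext => x; rewrite -[LHS]/(- Num.min (- g x) (- h x)) /=; lia.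
Qed.

Definition pos_set g := [set x | 0 < g x].

Record compact_lgroup X G : Prop := CompactLGroup {
  lgroup_subgroup : subgroup G;
  lgroup_min : forall g h, G g -> G h -> G (g \min h);
  lgroup_off : forall g x, G g -> ~ X x -> g x = 0;
  lgroup_compact : forall g J, G g -> set_ideal J ->
    (forall x, 0 < g x -> exists h, [/\ G h, 0 < h x & J (pos_set h)]) -> J (pos_set g) }.

Definition pos_topology X G : set (set T) := [set W | W `<=` X /\
  forall x, W x -> exists g, [/\ G g, 0 < g x & pos_set g `<=` W]].

Definition pos_closed X G C := C `<=` X /\ pos_topology X G (X `\` C).

Definition peak_points G C := [set x | C x /\
  exists g, [/\ G g, forall y, C y -> 0 <= g y <= 1 & g x = 1]].

Definition derived G C := C `\` peak_points G C.

Lemma pos_closed_bigcap X G (I : Type) (F : set I) (C : I -> set T) :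
  (forall i, F i -> pos_closed X G (C i)) ->
  pos_closed X G [set x | X x /\ forall i, F i -> C i x].
Proof.
move=> clC; split=> [x [] //|]; split=> [x [] //|x [Xx nCx]].
have [i Fi nCix] : exists2 i, F i & ~ C i x.
  apply: contrapT => nF; apply: nCx; split=> // i Fi.
  by apply: contrapT => nCix; apply: nF; exists i.
have [_ [_ /(_ x (conj Xx nCix)) [g [Gg gx gC]]]] := clC i Fi.
exists g; split=> // y /gC [Xy nCiy]; split=> // -[_ /(_ i Fi)]; exact: nCiy.
Qed.

Section LGroup.
Variables (X : set T) (G : set (T -> int)).
Hypothesis cG : compact_lgroup X G.
Let sG : subgroup G. Proof. exact: lgroup_subgroup cG. Qed.

Lemma lgroup_max g h : G g -> G h -> G (g \max h).
Proof. by apply: min_closed_max => //; exact: lgroup_min cG. Qed.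

Lemma lgroup_pos g : G g -> G (g \max 0).
Proof. by move=> Gg; exact: lgroup_max sG.1. Qed.

Lemma pos_set_sub g : G g -> pos_set g `<=` X.
Proof.
by move=> Gg x; rewrite /pos_set /= => gx; apply: contrapT => /(lgroup_off cG Gg) g0; lia.
Qed.

Lemma lgroup_compact_on C g J : pos_closed X G C -> G g -> set_ideal J ->
  (forall x, C x -> 0 < g x -> exists h, [/\ G h, 0 < h x & J (C `&` pos_set h)]) ->
  J (C `&` pos_set g).
Proof.
move=> [_ [_ opC]] Gg [J0 JU JS] locJ.
apply: (lgroup_compact cG (J := [set W | J (C `&` W)])) => //.
  split=> [|U V /= CU CV|U V UV]; rewrite /= ?setI0 ?setIUr //; first exact: JU.
  by apply: JS; exact: setIS.
move=> x gx; have [Cx|nCx] := pselect (C x); first exact: locJ.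
have [h [Gh hx hC]] := opC x (conj (pos_set_sub Gg gx) nCx).
by exists h; split=> //; apply: JS J0 => y [Cy /hC []].
Qed.

Lemma pos_closed_derived C : pos_closed X G C -> pos_closed X G (derived G C).
Proof.
move=> [CX [_ opC]]; split=> [x [/CX] //|]; split=> [x [] //|x [Xx nDx]].
have [Cx|nCx] := pselect (C x); last first.
  have [g [Gg gx gC]] := opC x (conj Xx nCx); exists g; split=> // y /gC [Xy nCy].
  by split=> // -[].
have [g [Gg g01 gx]] : exists g, [/\ G g, forall y, C y -> 0 <= g y <= 1 & g x = 1].
  by apply: contrapT => npk; apply: nDx; split=> // -[_].
exists g; split=> //; first by rewrite gx.
move=> y gy; split; first exact: pos_set_sub gy.
move=> [Cy]; apply; split=> //; exists g; split=> //.
by have := g01 y Cy; move: gy; rewrite /pos_set /=; lia.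
Qed.

Section Layer.
Variable C : set T.
Hypothesis clC : pos_closed X G C.
Let D := peak_points G C.

Definition layer_group := [set f : T -> int | (forall x, ~ D x -> f x = 0) /\
  exists2 g, G g & forall x, C x -> g x = f x].
Let Q := layer_group.

Lemma subgroup_layer : subgroup Q.
Proof.
split; first by split=> //; exists 0 => //; exact: sG.1.
move=> f f' [f0 [g Gg gf]] [f0' [g' Gg' gf']]; split=> [x nDx|].
  by rewrite -[LHS]/(f x - f' x) f0 // f0' // subrr.
by exists (g - g') => [|x Cx]; [exact: sG.2|rewrite -[LHS]/(g x - g' x) gf // gf'].
Qed.

Lemma layer_supp f x : Q f -> f x != 0 -> D x.
Proof. by move=> [f0 _] fx; apply: contrapT => /f0 /eqP; rewrite (negbTE fx). Qed.

Lemma layer_indicator_sub U : Q (indicator U) -> U `<=` D.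
Proof. by move=> QU x Ux; apply: layer_supp QU _; rewrite indicator_in. Qed.

Lemma layer_indicator_pos_set U : Q (indicator U) ->
  exists2 g, G g & U = C `&` pos_set g.
Proof.
move=> QU; have [_ [g Gg gU]] := QU; exists g => //; apply/seteqP; split=> x.
  move=> Ux; have [Cx _] := layer_indicator_sub QU Ux.
  by split; rewrite // /pos_set /= gU // indicator_in.
move=> [Cx]; rewrite /pos_set /= gU // => gx.
by apply: contrapT => nUx; rewrite indicator_notin // ltxx in gx.
Qed.

Lemma layer_indicatorI U V : Q (indicator U) -> Q (indicator V) -> Q (indicator (U `&` V)).
Proof.
move=> QU QV; have [_ [g Gg gU]] := QU; have [_ [h Gh hV]] := QV; split=> [x nDx|].
  by apply: indicator_notin => -[/(layer_indicator_sub QU)].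
exists (g \min h) => [|x Cx]; first exact: (lgroup_min cG).
rewrite indicatorI -[RHS]/(_ * _) /= gU // hV // /indicator.
by case: asboolP => _; case: asboolP => _.
Qed.

Let layer_indicatorD := indicator_memD subgroup_layer layer_indicatorI.
Let layer_indicatorU := indicator_memU subgroup_layer layer_indicatorI.

Lemma layer_indicator_small h : G h -> (forall y, C y -> 0 <= h y <= 1) ->
  Q (indicator (C `&` pos_set h)).
Proof.
move=> Gh h01; split=> [x nDx|].
  apply: indicator_notin => -[Cx hx]; apply: nDx; split=> //.
  by exists h; split=> //; have := h01 x Cx; move: hx; rewrite /pos_set /=; lia.
exists h => // x Cx; have := h01 x Cx; have [hx|hx] := ltP 0 (h x).
  by rewrite indicator_in //; lia.
by rewrite indicator_notin; [lia|case=> _; rewrite /pos_set /=; lia].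
Qed.

Lemma layer_base x g : D x -> G g -> 0 < g x ->
  exists U, [/\ Q (indicator U), U x & U `<=` pos_set g].
Proof.
move=> [Cx [h [Gh h01 hx]]] Gg gx.
exists (C `&` pos_set (h \min (g \max 0))); split.
- apply: layer_indicator_small => [|y /h01 /=]; last by lia.
  by apply: (lgroup_min cG) => //; exact: lgroup_pos.
- by split=> //; rewrite /pos_set /= hx -[X in Num.max _ X]/0; lia.
- by move=> y [_]; rewrite /pos_set /= -[X in Num.max _ X]/0; lia.
Qed.

Lemma layer_indicator_pos g : G g -> C `&` pos_set g `<=` D -> Q (indicator (C `&` pos_set g)).
Proof.
move=> Gg gD.
have [U [_ [u Gu uU]] gU] : exists2 U, Q (indicator U) & C `&` pos_set g `<=` U.
  apply: (lgroup_compact_on clC Gg (J := [set W | exists2 U, Q (indicator U) & W `<=` U])).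
    split=> [|W W' [U QU WU] [U' QU' WU']|W W' WW' [U QU WU]].
    - by exists set0; first exact: indicator_mem0 subgroup_layer.
    - by exists (U `|` U'); [exact: layer_indicatorU|exact: setUSS].
    - by exists U => //; exact: subset_trans WU.
  move=> x Cx gx; have [_ [h [Gh h01 hx]]] := gD x (conj Cx gx).
  by exists h; split; rewrite ?hx //; exists (C `&` pos_set h) => //; exact: layer_indicator_small.
split=> [x nDx|]; first by apply: indicator_notin => /gD.
exists (u \min (g \max 0)) => [|x Cx]; first by apply: (lgroup_min cG) => //; exact: lgroup_pos.
rewrite /= uU // -[X in Num.max _ X]/0; have [gx|gx] := ltP 0 (g x).
  by rewrite !indicator_in //; [lia|exact: gU].
rewrite (@indicator_notin _ (C `&` _)); last by case=> _; rewrite /pos_set /=; lia.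
by rewrite /indicator; case: asboolP => _ /=; lia.
Qed.

Lemma layer_pos f : Q f -> Q (f \max 0).
Proof.
move=> [f0 [g Gg gf]]; split=> [x /f0 /= ->|]; first by rewrite maxxx.
by exists (g \max 0); [exact: lgroup_pos|move=> x /gf /= ->].
Qed.

Lemma layer_pos_set f : Q f -> Q (indicator (pos_set f)).
Proof.
move=> Qf; have [_ [g Gg gf]] := Qf; have f_supp : pos_set f `<=` D.
  by move=> x fx; apply: layer_supp Qf _; rewrite gt_eqF.
have fg : pos_set f = C `&` pos_set g.
  apply/seteqP; split=> x; rewrite /pos_set; last by move=> [Cx] /=; rewrite gf.
  by move=> fx; have [Cx _] := f_supp x fx; split; rewrite //= gf.
by rewrite fg; apply: layer_indicator_pos; rewrite -?fg.
Qed.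

Lemma layer_bounded f : Q f -> exists n : nat, forall x, f x <= n%:Z.
Proof.
move=> Qf; have [f0 [g Gg gf]] := Qf.
have [n gn] : exists n : nat, forall x, (C `&` pos_set g) x -> g x <= n%:Z.
  apply: (lgroup_compact_on clC Gg (J := [set W | exists n : nat, forall x, W x -> g x <= n%:Z])).
    split=> [|W W' [m Wm] [n Wn]|W W' WW' [n Wn]].
    - by exists 0%N.
    - by exists (m + n)%N => x [/Wm|/Wn]; lia.
    - by exists n => x /WW'; exact: Wn.
  move=> x Cx gx; have [_ [u [Gu u01 ux]]] : D x.
    by apply: layer_supp Qf _; rewrite -gf // gt_eqF.
  have hE y : (u *~ (g x + 1) - g) y = u y * (g x + 1) - g y.
    by rewrite -[LHS]/((u *~ _) y - g y) fct_mulrzE mulrzz.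
  exists (u *~ (g x + 1) - g); split; first by apply: sG.2 => //; exact: subgroupMz.
    by rewrite hE ux mul1r addrAC subrr add0r.
  by exists `|(g x + 1)%R|%N => y [/u01 u01y]; rewrite /pos_set /= hE; nia.
exists n => x; have [fx|] := ltP 0 (f x); last by lia.
have [Cx _] : D x by apply: layer_supp Qf _; rewrite gt_eqF.
by rewrite -gf //; apply: gn; split; rewrite /pos_set //= gf.
Qed.

Lemma layer_spanned : indicator_spanned Q.
Proof.
have sQ := subgroup_layer; split=> //; first exact: layer_indicatorI.
set Z := smallest _ _; have sZ : subgroup Z by exact: subgroup_smallest.
have ZU U : Q (indicator U) -> Z (indicator U) by move=> QU; apply: sub_gen_smallest; exists U.
have Z_bounded (n : nat) f : Q f -> (forall x, 0 <= f x <= n%:Z) -> Z f.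
  elim: n f => [|n IHn] f Qf fn.
    rewrite (_ : f = 0); first exact: sZ.1.
    by apply/funext => x; have := fn x; rewrite -[RHS]/(0 : int); lia.
  have QU := layer_pos_set Qf; rewrite -(subrK (indicator (pos_set f)) f).
  apply: (subgroupD sZ); last exact: ZU.
  apply: IHn => [|x]; first exact: sQ.2.
  rewrite -[(_ - _) x]/(f x - indicator (pos_set f) x); have := fn x.
  have [fx|fx] := ltP 0 (f x); first by rewrite indicator_in //; lia.
  by rewrite indicator_notin /pos_set /=; lia.
move=> f Qf; have QNf := subgroupN sQ Qf.
have [n fn] := layer_bounded Qf; have [m fm] := layer_bounded QNf.
rewrite (_ : f = (f \max 0) - (- f \max 0)); last first.
  by apply/funext => x; rewrite -[RHS]/(Num.max (f x) 0 - Num.max (- f x) 0); lia.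
have pos_le h (k : nat) : (forall x, h x <= k%:Z) -> forall x, 0 <= (h \max 0) x <= k%:Z.
  by move=> hk x; rewrite /= le_max lexx orbT ge_max hk.
by apply: sZ.2; [apply: (Z_bounded n)|apply: (Z_bounded m)];
  [exact: layer_pos|exact: pos_le|exact: layer_pos|exact: pos_le].
Qed.

Lemma free_mod_layer_group : free_mod [set 0] Q.
Proof. exact: free_mod_indicator_spanned layer_spanned. Qed.

Let tau := subspace (pos_topology X G) D.

Lemma layer_openP V : tau V <-> V `<=` D /\
  forall x, V x -> exists U, [/\ Q (indicator U), U x & U `<=` V].
Proof.
split=> [[W [[WX Wop] ->]]|[VD Vop]].
  split=> [x [] //|x [Wx Dx]]; have [g [Gg gx gW]] := Wop x Wx.
  have [U [QU Ux Ug]] := layer_base Dx Gg gx; exists U; split=> // y Uy.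
  by split; [exact/gW/Ug|exact: layer_indicator_sub QU _ Uy].
exists [set x | exists g, [/\ G g, 0 < g x & D `&` pos_set g `<=` V]]; split.
  split=> [x [g [Gg gx _]]|x [g [Gg gx gV]]]; first exact: pos_set_sub gx.
  by exists g; split=> // y gy; exists g.
apply/seteqP; split=> [x Vx|x [[g [Gg gx gV]] Dx]]; last by apply: gV.
have [U [QU Ux UV]] := Vop x Vx; have [g Gg UE] := layer_indicator_pos_set QU.
split; last exact: VD.
exists g; split=> [//||y [[Cy _] gy]]; first by move: Ux; rewrite UE => -[].
by apply: UV; rewrite UE.
Qed.

Lemma layer_open U : Q (indicator U) -> tau U.
Proof.
by move=> QU; apply/layer_openP; split=> [|x Ux]; [exact: layer_indicator_sub|exists U; split].
Qed.

Lemma layer_compact U : Q (indicator U) -> compact_in tau U.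
Proof.
move=> QU; apply/compact_inP => J idJ locJ; have [J0 JU JS] := idJ.
have [g Gg UE] := layer_indicator_pos_set QU; rewrite UE.
apply: lgroup_compact_on => // x Cx gx.
have /locJ [V [/layer_openP [_ Vop] Vx JV]] : U x by rewrite UE.
have [W [QW Wx WV]] := Vop x Vx; have [h Gh WE] := layer_indicator_pos_set QW.
exists h; rewrite -WE; split=> //; first by move: Wx; rewrite WE => -[].
exact: JS JV.
Qed.

Lemma layer_locally_constant f x : Q f -> D x ->
  exists U, [/\ Q (indicator U), U x & forall y, U y -> f y = f x].
Proof.
move=> Qf Dx; have [g [Gg g01 gx]] := Dx.2.
have [|V [QV Vx _]] := layer_base Dx Gg; first by rewrite gx.
move: f Qf => f /(indicator_spanned_sub layer_spanned); move: f.
apply: (@smallest_sub _ _ _ [set f : T -> int | exists U,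
  [/\ Q (indicator U), U x & forall y, U y -> f y = f x]]).
  split=> [|f f' [U [QU Ux fU]] [U' [QU' Ux' fU']]]; first by exists V.
  exists (U `&` U'); split=> // [|y [Uy Uy']]; first exact: layer_indicatorI.
  by rewrite -[LHS]/(f y - f' y) -[RHS]/(f x - f' x) fU // fU'.
move=> _ [W QW <-]; have [Wx|nWx] := pselect (W x).
  by exists W; split=> // y Wy; rewrite !indicator_in.
by exists (V `\` W); split=> // [|y [_ nWy]]; [exact: layer_indicatorD|rewrite !indicator_notin].
Qed.

Lemma layer_continuous f : Q f -> continuous_Z tau D f.
Proof.
move=> Qf A; apply/layer_openP; split=> [x [] //|x [Dx Ax]].
have [U [QU Ux Uf]] := layer_locally_constant Qf Dx; exists U; split=> // y Uy.
by split; [exact: layer_indicator_sub QU _ Uy|rewrite /preimage /= Uf].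
Qed.

Lemma layer_supp_indicator f : Q f -> Q (indicator [set x | D x /\ f x != 0]).
Proof.
move=> Qf; have QNf := subgroupN subgroup_layer Qf.
have := layer_indicatorU (layer_pos_set Qf) (layer_pos_set QNf); congr (Q (indicator _)).
apply/seteqP; split=> x; rewrite /pos_set /= oppr_gt0.
  move=> fx; suff fx0 : f x != 0 by split=> //; exact: layer_supp Qf fx0.
  by case: fx; lia.
by move=> [_]; rewrite neq_lt => /orP[]; [right|left].
Qed.

(* A continuous function on the layer is constant near each point on some [U]
   with indicator in the layer group, and finitely many such [U] cover a compact
   support. *)
Lemma continuous_compact_layer f : (forall x, ~ D x -> f x = 0) -> continuous_Z tau D f ->
  compact_in tau [set x | D x /\ f x != 0] -> Q f.
Proof.
move=> f0 cf /compact_inP cS; have sQ := subgroup_layer.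
have [U [QU fU SU]] : exists U,
    [/\ Q (indicator U), Q (f * indicator U) & [set x | D x /\ f x != 0] `<=` U].
  apply: (cS [set W | exists U, [/\ Q (indicator U), Q (f * indicator U) & W `<=` U]]).
    split=> [|W W' [U [QU fU WU]] [U' [QU' fU' WU']]|W W' WW' [U [QU fU WU]]].
    - exists set0; rewrite indicator0 mulr0; split=> //; exact: sQ.1.
    - exists (U `|` U'); split; [exact: layer_indicatorU| |exact: setUSS].
      rewrite indicatorU indicatorD indicatorI mulrDr mulrBr.
      rewrite [indicator U' * _]mulrC [f * (_ * _)]mulrA.
      apply: (subgroupD sQ) => //; apply: sQ.2 => //.
      by apply: (indicator_spannedM layer_spanned).
    - by exists U; split=> //; exact: subset_trans WU.
  move=> x [Dx fx]; have /layer_openP [_ fxop] := cf [set f x].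
  have [U [QU Ux fU]] := fxop x (conj Dx erefl).
  exists U; split=> //; first exact: layer_open.
  exists U; split=> //; rewrite (_ : f * indicator U = indicator U *~ f x); first exact: subgroupMz.
  apply/funext => y; rewrite -[LHS]/(f y * indicator U y) fct_mulrzE mulrzz mulrC.
  have [/fU [_ ->] //|nUy] := pselect (U y).
  by rewrite indicator_notin // !mul0r.
rewrite (_ : f = f * indicator U) //; apply/funext => x; rewrite -[RHS]/(f x * indicator U x).
have [->|fx] := eqVneq (f x) 0; first by rewrite mul0r.
rewrite indicator_in ?mulr1 //; apply: SU; split=> //.
by apply: contrapT => /f0 /eqP; rewrite (negbTE fx).
Qed.

Lemma closure_supp f : continuous_Z tau D f ->
  closure_in tau D [set x | D x /\ f x != 0] = [set x | D x /\ f x != 0].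
Proof.
move=> cf; apply/seteqP; split=> [x [Dx clx]|x [Dx fx]]; last by split=> // V _ Vx; exists x.
have [y [[_ fy] [_ /= yx]]] := clx _ (cf [set f x]) (conj Dx erefl).
by split=> //=; rewrite -yx.
Qed.

Lemma Cc_layer : Cc tau D = Q.
Proof.
apply/seteqP; split=> f; last first.
  move=> Qf; have cf := layer_continuous Qf; split; first by case: Qf.
  by split=> //; rewrite closure_supp //; apply: layer_compact; exact: layer_supp_indicator.
by move=> [f0 [cf]]; rewrite closure_supp //; exact: continuous_compact_layer.
Qed.

End Layer.
End LGroup.
End CompactLGroup.

(** * Derived sequences *)

Section DirectSum.
Variables (T : Type) (d : Order.disp_t) (I : orderType d) (alpha : I) (Q : I -> set (T -> int)).
Hypotheses (sQ : forall i, subgroup (Q i))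
  (Q_trivial : forall i, ~ (i < alpha)%O -> Q i `<=` [set 0]).

Definition single (i : I) (f : T -> int) : I -> T -> int := fun j => if j == i then f else 0.

Lemma single_eq i f : single i f i = f.
Proof. by rewrite /single eqxx. Qed.

Lemma single_neq i j f : j != i -> single i f j = 0.
Proof. by rewrite /single => /negbTE ->. Qed.

Lemma subgroup_dsum : subgroup (dsum alpha Q).
Proof.
split=> [|f g [fQ [f0 [s fs]]] [gQ [g0 [t gt]]]].
  by split=> [i _|]; [exact: (sQ i).1|split=> //; exists [::] => i []].
split=> [i ia|]; first by apply: (sQ i).2; [exact: fQ|exact: gQ].
split=> [i ia|]; first by rewrite -[LHS]/(f i - g i) f0 // g0 //; exact: subrr.
exists (s ++ t) => i; rewrite -[(f - g) i]/(f i - g i) mem_cat => fgi.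
have [fi0|/fs -> //] := pselect (f i = 0); apply/orP; right; apply: gt => gi0.
by apply: fgi; rewrite fi0 gi0; exact: subrr.
Qed.

Lemma dsum_single i f : Q i f -> dsum alpha Q (single i f).
Proof.
move=> Qf; split=> [j _|]; first by rewrite /single; case: eqP => [->//|_]; exact: (sQ j).1.
split=> [j ja|]; last by exists [:: i] => j; rewrite /single inE; case: eqP.
by rewrite /single; case: eqP => // ji; rewrite ji in ja; exact: Q_trivial ja _ Qf.
Qed.

Lemma dsum_generated (D : set I) f : dsum alpha Q f -> (forall i, f i <> 0 -> D i) ->
  smallest subgroup ([set 0] `|` \bigcup_(i in D) (single i @` Q i)) f.
Proof.
move=> [fQ [f0 [s fs]]] fD.
have -> : f = \sum_(i <- undup s) single i (f i).
  apply/funext => j; rewrite -[RHS]/(eval_at j _) raddf_sum /= /eval_at.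
  have [js|js] := boolP (j \in undup s).
    rewrite (bigD1_seq j) ?undup_uniq //= single_eq big1 ?addr0 // => i ij.
    by rewrite single_neq // eq_sym.
  rewrite big_seq big1 => [|i si]; last first.
    by rewrite single_neq //; apply: contraNneq js => ->.
  by apply: contrapT => /fs; rewrite -mem_undup; exact/negP.
apply: subgroup_sum => [|i _]; first exact: subgroup_smallest.
apply: sub_gen_smallest; have [fi0|fi] := pselect (f i = 0).
  by left; apply/funext => j; rewrite fi0 /single; case: ifP.
right; exists i; first exact: fD.
by exists (f i) => //; apply: fQ; apply: contrapT => /f0.
Qed.

Let lower i := [set f | dsum alpha Q f /\ forall j, (i <= j)%O -> f j = 0].

Lemma filtration_dsum : filtration [set 0] (dsum alpha Q) (fun i => single i @` Q i) lower.
Proof.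
have sS := subgroup_dsum; split=> [i _ ->|i|i j ij _ [f Qf <-]|i f [Sf fi]|i _ [f Qf <-]|f Sf].
- by split=> //; exact: sS.1.
- split=> [|f g [Sf fi] [Sg gi]]; first by split=> //; exact: sS.1.
  by split=> [|j ij]; [exact: sS.2|rewrite -[LHS]/(f j - g j) fi // gi //; exact: subrr].
- split=> [|k jk]; first exact: dsum_single.
  by rewrite single_neq // gt_eqF // (lt_le_trans ij jk).
- by apply: dsum_generated => // j fj; rewrite /= ltNge; apply/negP => /fi.
- exact: dsum_single.
- exact: dsum_generated.
Qed.

Lemma dsum_quotient_iso i :
  quotient_iso (@eval_at I (T -> int) i) (lower i) (single i @` Q i) [set 0] (Q i).
Proof.
split=> [_ [f Qf <-]|_ [f Qf <-]|f Qf]; rewrite /= /eval_at.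
- by rewrite single_eq.
- rewrite single_eq; split=> [->|[_ /(_ i (lexx i))]]; last by rewrite single_eq.
  rewrite (_ : single i 0 = 0); last by apply/funext => j; rewrite /single; case: ifP.
  by split=> //; exact: subgroup_dsum.1.
- by exists (single i f); [exists f|rewrite /= single_eq subrr].
Qed.

Lemma subgroup_single_image i : subgroup (single i @` Q i).
Proof.
split; first by exists 0; [exact: (sQ i).1|apply/funext => j; rewrite /single; case: ifP].
move=> _ _ [f Qf <-] [g Qg <-]; exists (f - g); first exact: (sQ i).2.
by apply/funext => j; rewrite -[RHS]/(single i f j - single i g j) /single; case: ifP.
Qed.

End DirectSum.

Section Successors.
Variables (d : Order.disp_t) (I : orderType d).
Hypothesis wfI : well_founded (fun i j : I => (i < j)%O).
Implicit Types i j k : I.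

Lemma is_succ_exists i j : (i < j)%O -> exists k, is_succ i k.
Proof.
elim/(well_founded_ind wfI): j => j IH ij.
have [[k [ik kj]]|nk] := pselect (exists k, (i < k)%O /\ (k < j)%O); first exact: IH kj ik.
by exists j; split=> // k ikj; apply: nk; exists k.
Qed.

Lemma is_succ_le i j k : is_succ i j -> (i < k)%O -> (j <= k)%O.
Proof. by move=> [_ nij] ik; rewrite leNgt; apply/negP => kj; exact: (nij k). Qed.

Lemma lt_is_succ i j k : is_succ i j -> (k < j)%O -> (k <= i)%O.
Proof. by move=> [_ nij] kj; rewrite leNgt; apply/negP => ik; exact: (nij k). Qed.

End Successors.

Section DerivedSequence.
Variables (T : Type) (X : set T) (G : set (T -> int)).
Hypothesis cG : compact_lgroup X G.
Let sG : subgroup G. Proof. exact: lgroup_subgroup cG. Qed.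

Definition vanishing (Y : set T) := [set g | G g /\ forall x, Y x -> g x = 0].

Lemma subgroup_vanishing Y : subgroup (vanishing Y).
Proof.
split=> [|f g [Gf f0] [Gg g0]]; first by split=> //; exact: sG.1.
by split=> [|x Yx]; [exact: sG.2|rewrite -[LHS]/(f x - g x) f0 // g0 // subrr].
Qed.

Lemma vanishingS Y Y' : Y `<=` Y' -> vanishing Y' `<=` vanishing Y.
Proof. by move=> YY' g [Gg g0]; split=> // x /YY' /g0. Qed.

Lemma layer_quotient_iso C : quotient_iso (indicator C \o* idfun)
  (vanishing C) (vanishing (derived G C)) [set 0] (layer_group G C).
Proof.
have resE g x : C x -> (g * indicator C) x = g x.
  by move=> Cx; rewrite -[LHS]/(g x * indicator C x) indicator_in // mulr1.
have res0 g x : ~ C x -> (g * indicator C) x = 0.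
  by move=> nCx; rewrite -[LHS]/(g x * indicator C x) indicator_notin // mulr0.
split=> [g [Gg g0]|g [Gg _]|f [f0 [g Gg gf]]] /=.
- split=> [x nDx|]; last by exists g => // x Cx; rewrite resE.
  by have [Cx|nCx] := pselect (C x); [rewrite resE // g0|rewrite res0].
- split=> [gC|[_ g0]]; first by split=> // x Cx; rewrite -resE // gC.
  by apply/funext => x; have [Cx|nCx] := pselect (C x); [rewrite resE // g0|rewrite res0].
- exists g; first by split=> // x [Cx nDx]; rewrite gf // f0.
  apply/eqP; rewrite subr_eq0; apply/eqP/funext => x.
  have [Cx|nCx] := pselect (C x); first by rewrite resE // gf.
  by rewrite res0 // f0 // => -[].
Qed.

Variables (d : Order.disp_t) (I : orderType d) (C : I -> set T).
Hypothesis wfI : well_founded (fun i j : I => (i < j)%O).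

Definition derived_seq := (forall i j, is_succ i j -> C j = derived G (C i)) /\
  (forall j, (forall i, ~ is_succ i j) -> C j = [set x | X x /\ forall i, (i < j)%O -> C i x]).

Hypothesis dC : derived_seq.

Lemma derived_seq_closed i : pos_closed X G (C i).
Proof.
elim/(well_founded_ind wfI): i => i IH; have [Csucc Clim] := dC.
have [[k ki]|nsucc] := pselect (exists k, is_succ k i).
  by rewrite (Csucc k i ki); apply: (pos_closed_derived cG); apply: IH; case: ki.
rewrite Clim => [|j ji]; last by apply: nsucc; exists j.
exact: (pos_closed_bigcap (F := [set j | (j < i)%O])).
Qed.

Lemma derived_seq_sub i j : (i < j)%O -> C j `<=` derived G (C i).
Proof.
elim/(well_founded_ind wfI): j => j IH ij; have [Csucc Clim] := dC.
have [[k kj]|nsucc] := pselect (exists k, is_succ k j).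
  rewrite (Csucc k j kj); have := lt_is_succ kj ij; rewrite le_eqVlt => /orP[/eqP -> //|ik].
  by move=> x [Ckx _]; exact: IH kj.1 ik x Ckx.
have [k ik] := is_succ_exists wfI ij; rewrite -(Csucc i k ik).
rewrite (Clim j) => [x [_ Cx]|l lj]; last by apply: nsucc; exists l.
apply: Cx; have := is_succ_le ik ij; rewrite le_eqVlt => /orP[/eqP kj|//].
by case: nsucc; exists i; rewrite -kj.
Qed.

Let C_anti i j : (i <= j)%O -> C j `<=` C i.
Proof. by rewrite le_eqVlt => /orP[/eqP -> //|/derived_seq_sub ij x /ij []]. Qed.

(* Compactness: the sets [~` C k] with [k < i] increase. *)
Lemma pos_set_avoids_lower i g : G g ->
  (forall x, pos_set g x -> exists2 k, (k < i)%O & ~ C k x) ->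
  pos_set g `<=` set0 \/ exists2 k, (k < i)%O & pos_set g `<=` ~` C k.
Proof.
move=> Gg g_lower; apply: (lgroup_compact cG Gg
  (J := [set W | W `<=` set0 \/ exists2 k, (k < i)%O & W `<=` ~` C k])).
  split=> [|W W' [W0|[k ki Wk]] [W0'|[k' ki' Wk']]|W W' WW' [W0|[k ki Wk]]].
  - by left.
  - by left=> x [/W0|/W0'].
  - by right; exists k' => // x [/W0|/Wk'].
  - by right; exists k => // x [/Wk|/W0'].
  - right; exists (Order.max k k'); first by rewrite gt_max ki.
    by move=> x [/Wk nCx|/Wk' nCx] /(C_anti _) Cx; apply: nCx; apply: Cx;
      rewrite le_max lexx ?orbT.
  - by left; exact: subset_trans W0.
  - by right; exists k => //; exact: subset_trans Wk.
move=> x gx; have [k ki nCx] := g_lower x gx.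
have [_ [_ Ck_op]] := derived_seq_closed k.
have [h [Gh hx hC]] := Ck_op x (conj (pos_set_sub cG Gg gx) nCx).
by exists h; split=> //; right; exists k => // y /hC [].
Qed.

Lemma vanishing_pred i g : vanishing (C i) g ->
  g = 0 \/ exists2 j, (j < i)%O & vanishing (derived G (C j)) g.
Proof.
move=> [Gg g0]; have [Csucc Clim] := dC.
have [[k ki]|nsucc] := pselect (exists k, is_succ k i).
  by right; exists k; [case: ki|rewrite -(Csucc k i ki)].
have Gabs : G (g \max (- g)) by apply: (lgroup_max cG) => //; exact: subgroupN.
have supp_abs x : pos_set (g \max (- g)) x <-> g x <> 0.
  by rewrite /pos_set /= -[(- g) x]/(- g x); lia.
have [x /supp_abs gx|noS|[k ki kS]] := pos_set_avoids_lower (i := i) Gabs; last 1 first.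
- right; exists k => //; apply: (vanishingS (Y' := C k)) => [x []//|]; split=> // x Cx.
  by apply: contrapT => /supp_abs /kS; exact.
- apply: contrapT => nex; apply: (gx); apply: g0; rewrite Clim => [|j ji].
    split=> [|k ki]; last by apply: contrapT => nCx; apply: nex; exists k.
    by apply: (pos_set_sub cG Gabs); exact/supp_abs.
  by apply: nsucc; exists j.
- by left; apply/funext => x; apply: contrapT => /supp_abs /noS.
Qed.

Variable alpha : I.
Hypothesis C_alpha : C alpha = set0.

Lemma filtration_vanishing :
  filtration [set 0] G (fun i => vanishing (derived G (C i))) (fun i => vanishing (C i)).
Proof.
have pred i : vanishing (C i) `<=` smallest subgroup
    ([set 0] `|` \bigcup_(j in [set j : I | (j < i)%O]) vanishing (derived G (C j))).
  move=> g /vanishing_pred g_pred; apply: sub_gen_smallest.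
  by case: g_pred => [->|[j ji gj]]; [left|right; exists j].
split=> // [i _ ->|i|i j ij|i g [] //|g Gg].
- exact: (subgroup_vanishing (C i)).1.
- exact: subgroup_vanishing.
- exact/vanishingS/derived_seq_sub.
- have : vanishing (C alpha) g by split; rewrite // C_alpha.
  move/pred; apply: sub_smallest2r; first exact: subgroup_smallest.
  by apply: setUS => x [j _ xj]; exists j.
Qed.

Theorem derived_seq_decomposition :
  (exists phi, set_iso G (dsum alpha (fun i => layer_group G (C i))) +%R +%R phi) /\
  free_abelian G +%R.
Proof.
pose Q i := layer_group G (C i); have sQ i : subgroup (Q i) by exact: (subgroup_layer cG).
have s0 (i : I) : subgroup [set (0 : T -> int)] by [].
have Q_trivial i : ~ (i < alpha)%O -> Q i `<=` [set 0].
  move=> /negP; rewrite -leNgt => ai f [f0 _]; apply/funext => x; apply: f0 => -[Cx _].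
  suff : C alpha x by rewrite C_alpha.
  by move: ai Cx; rewrite le_eqVlt => /orP[/eqP -> //|/derived_seq_sub ai /ai []].
have [B bas] := choice (fun i => free_mod_layer_group cG (derived_seq_closed i) :
  exists B, basis_mod [set 0] (Q i) B idfun).
have [b basG] := basis_of_graded wfI subgroup_set0 filtration_vanishing
  (fun i => subgroup_vanishing _) s0 (fun i => layer_quotient_iso (C i)) bas.
have [b' basS] := basis_of_graded wfI subgroup_set0 (filtration_dsum sQ Q_trivial)
  (subgroup_single_image sQ) s0 (dsum_quotient_iso alpha sQ) bas.
split; first exact: basis_set_iso sG (subgroup_dsum alpha sQ) basG basS.
exact: basis_free_abelian sG basG.
Qed.

End DerivedSequence.

(** * Fractional ideals and valuations *)

Section ProductSets.
Variable K : fieldType.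
Implicit Types I J L P : set K.

Lemma prod_set_sub I J P : P 0 -> (forall x y, P x -> P y -> P (x + y)) ->
  (forall a b, I a -> J b -> P (a * b)) -> prod_set I J `<=` P.
Proof.
move=> P0 PD PM x [s [sIJ ->]]; rewrite big_seq.
by apply: (big_ind P) => // p /sIJ [? ?]; exact: PM.
Qed.

Lemma prod_set_mul I J a b : I a -> J b -> prod_set I J (a * b).
Proof.
move=> Ia Jb; exists [:: (a, b)]; split; last by rewrite big_seq1.
by move=> p; rewrite inE => /eqP ->.
Qed.

Lemma prod_set0 I J : prod_set I J 0.
Proof. by exists [::]; split=> //; rewrite big_nil. Qed.

Lemma prod_setD I J x y : prod_set I J x -> prod_set I J y -> prod_set I J (x + y).
Proof.
move=> [s [sP ->]] [t [tP ->]]; exists (s ++ t); split; last by rewrite big_cat.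
by move=> p; rewrite mem_cat => /orP[/sP|/tP].
Qed.

Lemma prod_setC I J : prod_set I J = prod_set J I.
Proof.
suff sub I' J' : prod_set I' J' `<=` prod_set J' I' by apply/seteqP.
apply: prod_set_sub; [exact: prod_set0|exact: prod_setD|].
by move=> a b Ia Jb; rewrite mulrC; exact: prod_set_mul.
Qed.

Lemma prod_set_scaler I J s x : (forall b, J b -> J (s * b)) ->
  prod_set I J x -> prod_set I J (s * x).
Proof.
move=> Js; move: x; apply: (@prod_set_sub _ _ [set x | prod_set I J (s * x)]) => /=.
- by rewrite mulr0; exact: prod_set0.
- by move=> x y; rewrite mulrDr; exact: prod_setD.
- by move=> a b Ia Jb; rewrite mulrCA; apply: prod_set_mul => //; exact: Js.
Qed.

Lemma prod_setA I J L : prod_set I (prod_set J L) = prod_set (prod_set I J) L.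
Proof.
suff sub I' J' L' : prod_set I' (prod_set J' L') `<=` prod_set (prod_set I' J') L'.
  apply/seteqP; split=> //; rewrite prod_setC (prod_setC I J) (prod_setC I).
  by rewrite (prod_setC J L); exact: sub.
apply: prod_set_sub => [||a x I'a]; [exact: prod_set0|exact: prod_setD|].
move: x; apply: (@prod_set_sub _ _ [set x | prod_set (prod_set I' J') L' (a * x)]) => /=.
- by rewrite mulr0; exact: prod_set0.
- by move=> x y; rewrite mulrDr; exact: prod_setD.
- by move=> b c J'b L'c; rewrite mulrA; apply: prod_set_mul => //; exact: prod_set_mul.
Qed.

Lemma prod_setACA I J L P :
  prod_set (prod_set I J) (prod_set L P) = prod_set (prod_set I L) (prod_set J P).
Proof. by rewrite -!prod_setA (prod_setA J) (prod_setC J) -prod_setA. Qed.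

Lemma prod_set_nonzero I J : prod_set I J 1 -> exists2 x, I x & x != 0.
Proof.
move=> IJ1; apply: contrapT => nex; have /eqP := oner_neq0 K; apply.
move: IJ1; apply: (@prod_set_sub _ _ [set 0]) => //= [x y -> ->|a b Ia _].
  by rewrite addr0.
have [->|a0] := eqVneq a 0; first by rewrite mul0r.
by case: nex; exists a.
Qed.

End ProductSets.

Section Ideals.
Variable K : fieldType.
Implicit Types S I J M P Q : set K.

Lemma subring0 S : subring S -> S 0.
Proof. by case=> S1 [SB _]; rewrite -(subrr 1); exact: SB. Qed.

Lemma subring_subgroup S : subring S -> subgroup S.
Proof. by move=> sS; split; [exact: subring0|case: sS => _ []]. Qed.

Lemma subringD S x y : subring S -> S x -> S y -> S (x + y).
Proof. by move=> /subring_subgroup; exact: subgroupD. Qed.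

Lemma subringX S x n : subring S -> S x -> S (x ^+ n).
Proof.
case=> S1 [_ SM] Sx; elim: n => [|n IHn]; rewrite ?expr0 ?exprS //; exact: SM.
Qed.

Lemma sr_ideal_addset S I J : subring S -> sr_ideal S I -> sr_ideal S J ->
  sr_ideal S (addset I J).
Proof.
move=> sS [IS [I0 [ID IM]]] [JS [J0 [JD JM]]]; split.
  by move=> _ [a /IS Sa [b /JS Sb <-]]; exact: subringD.
split; first by exists 0 => //; exists 0; rewrite ?addr0.
split=> [_ _ [a Ia [b Jb <-]] [a' Ia' [b' Jb' <-]]|s _ Ss [a Ia [b Jb <-]]].
  exists (a + a'); first exact: ID.
  by exists (b + b'); [exact: JD|rewrite addrACA].
exists (s * a); first exact: IM.
by exists (s * b); [exact: JM|rewrite mulrDr].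
Qed.

Lemma sr_ideal_full S I : sr_ideal S I -> I 1 -> I = S.
Proof.
move=> [IS [_ [_ IM]]] I1; apply/seteqP; split=> // x Sx.
by rewrite -[x]mulr1; exact: IM.
Qed.

Lemma sr_ideal_proper S I : sr_ideal S I -> I <> S -> ~ I 1.
Proof. by move=> idI IS /(sr_ideal_full idI). Qed.

Lemma exists_sr_maximal S I : subring S -> sr_ideal S I -> ~ I 1 ->
  exists2 M, sr_maximal S M & I `<=` M.
Proof.
move=> sS idI I1; pose proper := [set J | sr_ideal S (I `|` J) /\ ~ (I `|` J) 1].
have [F Fproper totF|A [[idA A1] maxA]] := @Zorn_bigcup _ proper.
  have memF x : (I `|` \bigcup_(J in F) J) x ->
      I x \/ exists J, [/\ F J, J x, sr_ideal S (I `|` J) & ~ (I `|` J) 1].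
    by move=> [Ix|[J FJ Jx]]; [left|right; exists J; have [? ?] := Fproper J FJ].
  have [IS [I0 [ID IM]]] := idI.
  have subF J : F J -> I `|` J `<=` I `|` \bigcup_(J in F) J.
    by move=> FJ; apply: setUS => x Jx; exists J.
  split; last by move=> /memF [//|[J [_ J1 _ nJ1]]]; apply: nJ1; right.
  split; first by move=> x /memF [/IS //|[J [_ Jx [JS _] _]]]; apply: JS; right.
  split; first by left.
  split=> [x y /memF [Ix|[J [FJ Jx [_ [_ [JD _]]] _]]]|s x Ss /memF [Ix|]].
  - move=> /memF [Iy|[J [FJ Jy [_ [_ [JD _]]] _]]]; first by left; exact: ID.
    by apply: (subF J FJ); apply: JD; [left|right].
  - move=> /memF [Iy|[J' [FJ' Jy [_ [_ [JD' _]]] _]]].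
      by apply: (subF J FJ); apply: JD; [right|left].
    have [JJ'|J'J] := totF J J' FJ FJ'.
      by apply: (subF J' FJ'); apply: JD'; right=> //; exact: JJ'.
    by apply: (subF J FJ); apply: JD; right=> //; exact: J'J.
  - by left; exact: IM.
  - move=> [J [FJ Jx [_ [_ [_ JM]]] _]]; apply: (subF J FJ); apply: JM => //; by right.
exists (I `|` A); last exact: subsetUl.
split=> //; split=> [e|J idJ AJ]; first by apply: A1; rewrite e; case: sS.
have IJ : I `|` J = J by apply/setUidPr; apply: subset_trans AJ; exact: subsetUl.
have [J1|nJ1] := pselect (J 1); [right; exact: sr_ideal_full|left].
have properJ : proper J by rewrite /proper /mkset IJ.
have JA : J `<=` A.
  apply: contrapT => nJA; apply: (maxA J) properJ.
  by split=> //; apply: subset_trans AJ; exact: subsetUr.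
by apply/seteqP; split=> // x /JA; right.
Qed.

Lemma sr_maximal_comax S M a : subring S -> sr_maximal S M -> S a -> ~ M a ->
  exists c m, [/\ S c, M m & 1 = c * a + m].
Proof.
move=> sS [idM [_ maxM]] Sa nMa; have [S1 [_ SM]] := sS; have S0 := subring0 sS.
pose Ja := [set c * a | c in S].
have idJ : sr_ideal S Ja.
  split; first by move=> _ [c Sc <-]; exact: SM.
  split; first by exists 0; rewrite ?mul0r.
  split=> [_ _ [c Sc <-] [c' Sc' <-]|s _ Ss [c Sc <-]].
    by exists (c + c'); [exact: subringD|rewrite mulrDl].
  by exists (s * c); [exact: SM|rewrite mulrA].
have Ja0 : Ja 0 by exists 0; rewrite ?mul0r.
have [|e|e] := maxM _ (sr_ideal_addset sS idJ idM); first exact: sub_addsetr.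
  exfalso; apply: nMa; rewrite -e; apply: sub_addsetl; first by case: idM => _ [].
  by exists 1; rewrite ?mul1r.
have : addset Ja M 1 by rewrite e.
by move=> [_ [c Sc <-] [m Mm <-]]; exists c, m.
Qed.

Lemma sr_maximal_prime S M : subring S -> sr_maximal S M -> sr_prime S M.
Proof.
move=> sS mM; have [idM [MS _]] := mM; have [_ [_ [MD MM]]] := idM.
split=> //; split=> // a b Sa Sb Mab; have [Ma|nMa] := pselect (M a); [by left|right].
have [c [m [Sc Mm e]]] := sr_maximal_comax sS mM Sa nMa.
by rewrite -[b]mul1r e mulrDl; apply: MD; [rewrite -mulrA; exact: MM|rewrite mulrC; exact: MM].
Qed.

Lemma sr_prime_exp S P x n : subring S -> sr_prime S P -> S x -> P (x ^+ n) -> P x.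
Proof.
move=> sS [idP [PS Pprime]] Sx; elim: n => [|n IHn].
  by rewrite expr0 => /(sr_ideal_proper idP PS).
by rewrite exprS => /(Pprime _ _ Sx (subringX n sS Sx)) [].
Qed.

Lemma sr_prime_contract S S' Q : subring S -> S `<=` S' -> sr_prime S' Q -> sr_prime S (Q `&` S).
Proof.
move=> sS SS' [idQ [QS' Qprime]]; have [_ [Q0 [QD QM]]] := idQ.
split.
  split; first by move=> x [].
  split; first by split=> //; exact: subring0.
  split=> [x y [Qx Sx] [Qy Sy]|s x Ss [Qx Sx]].
    by split; [exact: QD|exact: subringD].
  by split; [apply: QM => //; exact: SS'|case: sS => _ [_]; apply].
split=> [e|a b Sa Sb [Qab _]].
  by apply: (sr_ideal_proper idQ QS'); have [] : (Q `&` S) 1 by rewrite e; case: sS.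
by have [] := Qprime _ _ (SS' _ Sa) (SS' _ Sb) Qab; [left|right].
Qed.

(* A maximal ideal of S[1/a] containing the extension of I contracts to P. *)
Lemma exists_sr_prime_avoiding S I a : subring S -> sr_ideal S I -> S a ->
  (forall n, ~ I (a ^+ n)) -> exists P, [/\ sr_prime S P, I `<=` P & ~ P a].
Proof.
move=> sS [IS [I0 [ID IM]]] Sa nIa; have [S1 [SB SM]] := sS.
have a0 : a != 0 by apply/eqP => a0; apply: (nIa 1%N); rewrite a0 expr1.
pose S' := [set x | exists n, S (a ^+ n * x)].
pose I' := [set x | exists n, I (a ^+ n * x)].
have sS' : subring S'.
  split; first by exists 0%N; rewrite expr0 mulr1.
  split=> x y [m xm] [n yn]; exists (m + n)%N; last by rewrite exprD mulrACA; exact: SM.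
  rewrite exprD mulrBr -{1}(mulrC (a ^+ n)) -!mulrA.
  by apply: SB; apply: SM; rewrite //; exact: subringX.
have idI' : sr_ideal S' I'.
  split; first by move=> x [n /IS]; exists n.
  split; first by exists 0%N; rewrite mulr0.
  split=> x y [m xm] [n yn]; exists (m + n)%N; last by rewrite exprD mulrACA; exact: IM.
  rewrite exprD mulrDr -{1}(mulrC (a ^+ n)) -!mulrA.
  by apply: ID; apply: IM; rewrite //; exact: subringX.
have SS' : S `<=` S' by move=> x Sx; exists 0%N; rewrite expr0 mul1r.
have [[n]|Q mQ I'Q] := exists_sr_maximal sS' idI'; first by rewrite mulr1; exact: nIa.
exists (Q `&` S); split; first exact: sr_prime_contract (sr_maximal_prime sS' mQ).
  by move=> x Ix; split; [apply: I'Q; exists 0%N; rewrite expr0 mul1r|exact: IS].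
move=> [Qa _]; have [idQ [QS' _]] := mQ; apply: (sr_ideal_proper idQ QS').
rewrite -(mulVf a0); case: idQ => _ [_ [_ QM]]; apply: QM => //.
by exists 1%N; rewrite expr1 divff.
Qed.

End Ideals.

Section FractionalIdeals.
Variables (K : fieldType) (R : set K).
Hypothesis sR : subring R.
Implicit Types J L : set K.

Lemma frac_ideal_ring : frac_ideal R R.
Proof.
have [R1 [RB RM]] := sR; split; first exact: subring0.
split; first by move=> x y; exact: subringD.
by split=> //; exists 1; split; [exact: oner_neq0|split=> // x; rewrite mul1r].
Qed.

Lemma frac_ideal_prod J L : frac_ideal R J -> frac_ideal R L -> frac_ideal R (prod_set J L).
Proof.
move=> [J0 [JD [JM [d [d0 [Rd dJ]]]]]] [L0 [LD [LM [e [e0 [Re eL]]]]]].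
have [_ [_ RM]] := sR.
split; first exact: prod_set0.
split; first by move=> x y; exact: prod_setD.
split; first by move=> r x Rr; apply: prod_set_scaler => b; exact: LM.
exists (d * e); split; first exact: mulf_neq0.
split; first exact: RM.
apply: (@prod_set_sub _ _ _ [set x | R (d * e * x)]) => /=.
- by rewrite mulr0; exact: subring0.
- by move=> x y; rewrite mulrDr; exact: subringD.
- by move=> a b Ja Lb; rewrite mulrACA; apply: RM; [exact: dJ|exact: eL].
Qed.

Lemma frac_ideal_add J L : frac_ideal R J -> frac_ideal R L -> frac_ideal R (addset J L).
Proof.
move=> [J0 [JD [JM [d [d0 [Rd dJ]]]]]] [L0 [LD [LM [e [e0 [Re eL]]]]]].
have [_ [_ RM]] := sR.
split; first by exists 0 => //; exists 0; rewrite ?addr0.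
split=> [_ _ [a Ja [b Lb <-]] [a' Ja' [b' Lb' <-]]|].
  exists (a + a'); first exact: JD.
  by exists (b + b'); [exact: LD|rewrite addrACA].
split=> [r _ Rr [a Ja [b Lb <-]]|].
  exists (r * a); first exact: JM.
  by exists (r * b); [exact: LM|rewrite mulrDr].
exists (d * e); split; first exact: mulf_neq0.
split=> [|_ [a Ja [b Lb <-]]]; first exact: RM.
rewrite mulrDr; apply: subringD => //; first by rewrite mulrAC; apply: RM => //; exact: dJ.
by rewrite -mulrA; apply: RM => //; exact: eL.
Qed.

Lemma frac_ideal_cap J L : frac_ideal R J -> frac_ideal R L -> frac_ideal R (J `&` L).
Proof.
move=> [J0 [JD [JM [d [d0 [Rd dJ]]]]]] [L0 [LD [LM _]]]; split=> //.
split; first by move=> x y [Jx Lx] [Jy Ly]; split; [exact: JD|exact: LD].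
split; first by move=> r x Rr [Jx Lx]; split; [exact: JM|exact: LM].
by exists d; do 2!split=> //; move=> x [/dJ].
Qed.

Lemma prod_set_ringr J : frac_ideal R J -> prod_set J R = J.
Proof.
move=> [J0 [JD [JM _]]]; apply/seteqP; split.
  by apply: prod_set_sub => // a b Ja Rb; rewrite mulrC; exact: JM.
by move=> x Jx; rewrite -[x]mulr1; apply: prod_set_mul => //; case: sR.
Qed.

Lemma Inv_ring : Inv R R.
Proof.
have fR := frac_ideal_ring; split=> //; exists R; split=> //; exact: prod_set_ringr.
Qed.

Lemma Inv_inverse J : Inv R J -> exists2 J', Inv R J' & prod_set J J' = R.
Proof.
move=> [fJ [J' [fJ' JJ']]]; exists J' => //.
by split=> //; exists J; rewrite prod_setC.
Qed.

Lemma Inv_prod J L : Inv R J -> Inv R L -> Inv R (prod_set J L).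
Proof.
move=> [fJ [J' [fJ' JJ']]] [fL [L' [fL' LL']]]; split; first exact: frac_ideal_prod.
exists (prod_set J' L'); split; first exact: frac_ideal_prod.
by rewrite prod_setACA JJ' LL' prod_set_ringr //; exact: frac_ideal_ring.
Qed.

Lemma Inv_nonzero J : Inv R J -> exists2 x, J x & x != 0.
Proof. by move=> [_ [J' [_ JJ']]]; apply: (@prod_set_nonzero _ _ J'); rewrite JJ'; case: sR. Qed.

Lemma Inv_principal a : quotient_field_of R -> a != 0 -> Inv R [set r * a | r in R].
Proof.
move=> qR a0; have [R1 [RB RM]] := sR.
have frac c : c != 0 -> frac_ideal R [set r * c | r in R].
  move=> c0; split; first by exists 0; [exact: subring0|rewrite mul0r].
  split=> [_ _ [r Rr <-] [s Rs <-]|]; first by exists (r + s); [exact: subringD|rewrite mulrDl].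
  split=> [s _ Rs [r Rr <-]|]; first by exists (s * r); [exact: RM|rewrite mulrA].
  have [p [q [Rp [Rq [q0 cE]]]]] := qR c; exists q; split=> //; split=> // _ [r Rr <-].
  have -> : q * (r * c) = r * p by rewrite cE; field.
  exact: RM.
split; first exact: frac.
exists [set r * a^-1 | r in R]; split; first by apply: frac; rewrite invr_eq0.
apply/seteqP; split.
  apply: prod_set_sub; [exact: subring0|by move=> x y; exact: subringD|].
  move=> _ _ [r Rr <-] [s Rs <-]; rewrite mulrACA divff // mulr1; exact: RM.
move=> x Rx; have -> : x = (x * a) * (1 * a^-1) by field.
by apply: prod_set_mul; [exists x|exists 1].
Qed.

End FractionalIdeals.

Section Valuation.
Variables (K : fieldType) (w : K -> int).

Definition discrete_valuation :=
  [/\ forall x y, x != 0 -> y != 0 -> w (x * y) = w x + w y,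
      forall x y, x != 0 -> y != 0 -> x + y != 0 -> Num.min (w x) (w y) <= w (x + y) &
      exists t, t != 0 /\ w t = 1].

(* The value of [w] at [0] is irrelevant: [0] lies in every [val_ge n]. *)
Definition val_ge (n : int) : set K := [set x | x = 0 \/ n <= w x].

Lemma val_ge0 n : val_ge n 0. Proof. by left. Qed.

Lemma val_geE x n : x != 0 -> val_ge n x <-> n <= w x.
Proof. by move=> x0; split=> [[/eqP|//]|]; [rewrite (negbTE x0)|right]. Qed.

Lemma val_ge_le x m n : m <= n -> val_ge n x -> val_ge m x.
Proof. by move=> mn [->|nx]; [left|right; exact: le_trans nx]. Qed.

Hypothesis dw : discrete_valuation.

Lemma valM x y : x != 0 -> y != 0 -> w (x * y) = w x + w y.
Proof. by case: dw => wM _ _; exact: wM. Qed.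

Lemma val1 : w 1 = 0.
Proof. by apply: (addrI (w 1)); rewrite -valM ?oner_neq0 // mulr1 addr0. Qed.

Lemma valV x : x != 0 -> w x^-1 = - w x.
Proof. by move=> x0; apply/eqP; rewrite -addr_eq0 -valM ?invr_eq0 // mulVf // val1. Qed.

Lemma valX x n : x != 0 -> w (x ^+ n) = w x *+ n.
Proof.
by move=> x0; elim: n => [|n IHn]; rewrite ?expr0 ?val1 // exprS valM ?expf_neq0 // IHn mulrS.
Qed.

Lemma val_geD x y n : val_ge n x -> val_ge n y -> val_ge n (x + y).
Proof.
have [->|x0] := eqVneq x 0; first by rewrite add0r.
have [->|y0] := eqVneq y 0; first by rewrite addr0.
move=> /(val_geE _ x0) nx /(val_geE _ y0) ny; have [|xy0] := eqVneq (x + y) 0; [by left|right].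
by case: dw => _ /(_ x y x0 y0 xy0) + _; apply: le_trans; rewrite le_min nx.
Qed.

Lemma val_geM x y m n : val_ge m x -> val_ge n y -> val_ge (m + n) (x * y).
Proof.
have [->|x0] := eqVneq x 0; first by rewrite mul0r; left.
have [->|y0] := eqVneq y 0; first by rewrite mulr0; left.
by move=> /(val_geE _ x0) mx /(val_geE _ y0) ny; right; rewrite valM // lerD.
Qed.

Lemma val_geMl x y n : val_ge 0 x -> val_ge n y -> val_ge n (x * y).
Proof. by rewrite -{2}[n]add0r; exact: val_geM. Qed.

Lemma val_ge1_proper : ~ val_ge 1 1.
Proof. by move=> /(val_geE _ (oner_neq0 _)); rewrite val1. Qed.

Definition min_val (J : set K) n := J `<=` val_ge n /\ exists x, [/\ J x, x != 0 & w x = n].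

Lemma min_val_uniq J m n : min_val J m -> min_val J n -> m = n.
Proof.
move=> [Jm [x [Jx x0 wx]]] [Jn [y [Jy y0 wy]]].
have := Jm y Jy; have := Jn x Jx; rewrite !val_geE // wx wy => nm mn.
by apply/eqP; rewrite eq_le mn nm.
Qed.

Lemma min_val_prod J L m n : min_val J m -> min_val L n -> min_val (prod_set J L) (m + n).
Proof.
move=> [Jm [x [Jx x0 wx]]] [Ln [y [Ly y0 wy]]]; split; last first.
  exists (x * y); split; [exact: prod_set_mul|exact: mulf_neq0|by rewrite valM // wx wy].
apply: prod_set_sub; [exact: val_ge0|by move=> a b; exact: val_geD|].
by move=> a b /Jm ? /Ln ?; exact: val_geM.
Qed.

Lemma min_val_add J L m n : J 0 -> L 0 -> min_val J m -> min_val L n ->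
  min_val (addset J L) (Num.min m n).
Proof.
move=> J0 L0 [Jm [x [Jx x0 wx]]] [Ln [y [Ly y0 wy]]]; split=> [_ [a Ja [b Lb <-]]|].
  by apply: val_geD; [apply: val_ge_le (Jm a Ja)|apply: val_ge_le (Ln b Lb)];
    rewrite ge_min lexx ?orbT.
have [mn|nm] := leP m n; [exists x|exists y]; split=> //.
  exact: sub_addsetl.
exact: sub_addsetr.
Qed.

End Valuation.

Section LocalValuations.
Variables (K : fieldType) (R : set K) (v : set K -> K -> int).

Definition local_valuations := forall M, sr_maximal R M ->
  discrete_valuation (v M) /\ localization R M = val_ge (v M) 0.

Hypotheses (sR : subring R) (vR : local_valuations).

Section OnePrime.
Variable M : set K.
Hypothesis mM : sr_maximal R M.
Let dM : discrete_valuation (v M). Proof. by case: (vR mM). Qed.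

Lemma maximal0 : M 0. Proof. by case: mM => -[_ []]. Qed.

Lemma maximal_sub : M `<=` R. Proof. by case: mM => -[]. Qed.

Lemma local_denominator x : val_ge (v M) 0 x -> exists t, [/\ R t, ~ M t & R (t * x)].
Proof.
have [_ <-] := vR mM; move=> [a [t [Ra [Rt [nMt ->]]]]]; exists t; split=> //.
have t0 : t != 0 by apply: contra_notN nMt => /eqP ->; exact: maximal0.
by rewrite mulrC divfK.
Qed.

Lemma local_numerator x t : R t -> ~ M t -> R (t * x) -> val_ge (v M) 0 x.
Proof.
move=> Rt nMt Rtx; have [_ <-] := vR mM; exists (t * x), t; do 3!split=> //.
have t0 : t != 0 by apply: contra_notN nMt => /eqP ->; exact: maximal0.
by rewrite mulrC mulKf.
Qed.

Lemma ring_val_ge x : R x -> val_ge (v M) 0 x.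
Proof.
move=> Rx; apply: (local_numerator (t := 1)); rewrite ?mul1r //; first by case: sR.
by have [idM [MR _]] := mM; exact: sr_ideal_proper idM MR.
Qed.

Lemma maximal_valP x : R x -> M x <-> val_ge (v M) 1 x.
Proof.
move=> Rx; have [->|x0] := eqVneq x 0; first by split=> _; [left|exact: maximal0].
have vx := (val_geE _ _ x0).1 (ring_val_ge Rx); rewrite val_geE //; split=> [Mx|v1].
  suff : v M x != 0 by lia.
  apply/eqP => vx0; have [|t [Rt nMt Rtx]] := local_denominator (x := x^-1).
    by right; rewrite valV // vx0.
  apply: nMt; rewrite -[t](divfK x0).
  by case: mM => -[_ [_ [_ MM]]] _; exact: MM.
apply: contrapT => nMx; have := local_numerator (x := x^-1) Rx nMx.
rewrite divff // val_geE ?invr_eq0 // valV //.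
by case: sR => R1 _ /(_ R1); lia.
Qed.

Lemma val_unit x : R x -> ~ M x -> x != 0 /\ v M x = 0.
Proof.
move=> Rx nMx; have x0 : x != 0 by apply: contra_notN nMx => /eqP ->; exact: maximal0.
split=> //; have := (val_geE _ _ x0).1 (ring_val_ge Rx).
have : ~ 1 <= v M x by move=> v1; apply: nMx; apply/maximal_valP => //; right.
lia.
Qed.

Lemma exists_uniformizer : exists t, [/\ M t, t != 0 & v M t = 1].
Proof.
have [_ _ [t [t0 vt]]] := dM; have [|s [Rs nMs Rst]] := local_denominator (x := t).
  by right; rewrite vt.
have [s0 vs] := val_unit Rs nMs; have vst : v M (s * t) = 1 by rewrite valM // vs vt.
exists (s * t); split=> //; last exact: mulf_neq0.
by apply/maximal_valP => //; right; rewrite vst.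
Qed.

End OnePrime.

Lemma sr_ideal_full_locally I : sr_ideal R I ->
  (forall M, sr_maximal R M -> exists2 x, I x & ~ M x) -> I = R.
Proof.
move=> idI locI; apply: (sr_ideal_full idI); apply: contrapT => nI1.
have [M mM IM] := exists_sr_maximal sR idI nI1.
by have [x /IM] := locI M mM.
Qed.

Lemma mem_ring_locally x : (forall M, sr_maximal R M -> val_ge (v M) 0 x) -> R x.
Proof.
move=> vx; have [R1 [RB RM]] := sR; pose I := [set r | R r /\ R (r * x)].
have idI : sr_ideal R I.
  split; first by move=> r [].
  split; first by split; rewrite ?mul0r; exact: subring0.
  split=> [a b [Ra Rax] [Rb Rbx]|s a Rs [Ra Rax]].
    by split; rewrite ?mulrDl; exact: subringD.
  by split; rewrite -?mulrA; exact: RM.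
suff : I 1 by move=> [_]; rewrite mul1r.
rewrite (sr_ideal_full_locally idI) // => M mM.
by have [t [Rt nMt Rtx]] := local_denominator mM (vx M mM); exists t.
Qed.

Lemma prime_nonzero_maximal P a : sr_prime R P -> P a -> a != 0 -> sr_maximal R P.
Proof.
move=> pP Pa a0; have [idP [PR Pprime]] := pP; have [PsR [P0 [PD PM]]] := idP.
have [M mM PsM] := exists_sr_maximal sR idP (sr_ideal_proper idP PR).
suff -> : P = M by [].
apply/seteqP; split=> // x Mx; have Rx := maximal_sub mM Mx; have [dM _] := vR mM.
have [->//|x0] := eqVneq x 0.
have vx : 1 <= v M x by apply/val_geE => //; apply/(maximal_valP mM).
have va : 0 <= v M a by apply/val_geE => //; apply: (ring_val_ge mM); exact: PsR.
pose n := `|v M a|%N.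
have [|t [Rt nMt Rtxa]] := local_denominator mM (x := x ^+ n / a).
  right; rewrite valM ?invr_eq0 ?expf_neq0 // valV // valX // -mulr_natr /n; nia.
have Ptx : P (t * x ^+ n) by rewrite -[x ^+ n](divfK a0) mulrA; exact: PM.
have [/PsM //|] := Pprime _ _ Rt (subringX n sR Rx) Ptx; exact: sr_prime_exp pP Rx.
Qed.

End LocalValuations.

Lemma almost_dedekind_valuations (K : fieldType) (R : set K) :
  almost_dedekind R -> exists v, local_valuations R v.
Proof.
move=> [_ [_ dvr]].
suff [v vR] : {v : set K -> K -> int & forall M, sr_maximal R M ->
    discrete_valuation (v M) /\ localization R M = val_ge (v M) 0} by exists v.
apply: (@choice _ _ (fun M w => sr_maximal R M ->
  discrete_valuation w /\ localization R M = val_ge w 0)) => M.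
have [/dvr [w [wM [w_min [w_unif RM]]]]|nM] := pselect (sr_maximal R M); last by exists (fun=> 0).
exists w => _; split=> //; rewrite RM; apply/seteqP; split=> x.
  by move=> [->|[_]]; [left|right].
by have [->|x0] := eqVneq x 0; [left|move=> /(val_geE _ _ x0); right].
Qed.

(** * The value group *)

Section ValueGroup.
Variables (K : fieldType) (R : set K) (v : set K -> K -> int).
Hypotheses (sR : subring R) (qR : quotient_field_of R) (vR : local_valuations R v).
Implicit Types J L M : set K.

Definition ideal_val J M : int := xget 0 [set n | sr_maximal R M /\ min_val (v M) J n].

Lemma ideal_valE J M n : sr_maximal R M -> min_val (v M) J n -> ideal_val J M = n.
Proof.
move=> mM Jn; rewrite /ideal_val; case: xgetP => [m _ [_ Jm]|/(_ n) []]; last by split.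
exact: min_val_uniq Jm Jn.
Qed.

Lemma ideal_val_off J M : ~ sr_maximal R M -> ideal_val J M = 0.
Proof. by move=> nM; rewrite /ideal_val; case: xgetP => // n _ []. Qed.

Lemma frac_ideal_min_val J M : sr_maximal R M -> frac_ideal R J ->
  (exists2 x, J x & x != 0) -> exists n, min_val (v M) J n.
Proof.
move=> mM [J0 [JD [JM [c [c0 [Rc cJ]]]]]] [x Jx x0]; have [dM _] := vR mM.
have cval y : J y -> y != 0 -> 0 <= v M c + v M y.
  move=> Jy y0; rewrite -valM //; apply/val_geE; first exact: mulf_neq0.
  by apply: (ring_val_ge sR vR mM); exact: cJ.
pose attained n := `[< exists y, [/\ J y, y != 0 & v M c + v M y = n%:Z] >].
have ex_attained : exists n, attained n.
  exists `|(v M c + v M x)%R|%N; apply/asboolP; exists x; split=> //.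
  by rewrite gez0_abs //; exact: cval.
case: (ex_minnP ex_attained) => m /asboolP [y [Jy y0 vy]] m_min.
exists (v M y); split; last by exists y.
move=> z Jz; have [->|z0] := eqVneq z 0; [exact: val_ge0|right].
have := m_min `|(v M c + v M z)%R|%N; have cz := cval z Jz z0.
have -> : attained `|(v M c + v M z)%R|%N.
  by apply/asboolP; exists z; rewrite gez0_abs.
by move=> /(_ isT); rewrite -lez_nat gez0_abs // -vy lerD2l.
Qed.

Lemma ideal_valP J M : Inv R J -> sr_maximal R M -> min_val (v M) J (ideal_val J M).
Proof.
move=> iJ mM; have [n Jn] := frac_ideal_min_val mM iJ.1 (Inv_nonzero sR iJ).
by rewrite (ideal_valE mM Jn).
Qed.

Lemma ideal_val_ge J M x : Inv R J -> sr_maximal R M -> J x -> val_ge (v M) (ideal_val J M) x.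
Proof. by move=> iJ mM; case: (ideal_valP iJ mM) => + _; apply. Qed.

Lemma ideal_val_prod J L : Inv R J -> Inv R L ->
  ideal_val (prod_set J L) = ideal_val J + ideal_val L.
Proof.
move=> iJ iL; apply/funext => M; rewrite -[RHS]/(ideal_val J M + ideal_val L M).
have [mM|nM] := pselect (sr_maximal R M); last by rewrite !ideal_val_off.
apply: ideal_valE => //.
by apply: min_val_prod; [case: (vR mM)|exact: ideal_valP|exact: ideal_valP].
Qed.

Lemma ideal_val_ring : ideal_val R = 0.
Proof.
have := ideal_val_prod (Inv_ring sR) (Inv_ring sR).
rewrite (prod_set_ringr sR (frac_ideal_ring sR)) => /eqP.
by rewrite -subr_eq0 opprD addNKr oppr_eq0 => /eqP.
Qed.

Lemma Inv_val_inverse J : Inv R J ->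
  exists J', [/\ Inv R J', prod_set J J' = R & ideal_val J' = - ideal_val J].
Proof.
move=> iJ; have [J' iJ' JJ'] := Inv_inverse iJ; exists J'; split=> //.
by apply/eqP; rewrite -addr_eq0 addrC -ideal_val_prod // JJ' ideal_val_ring.
Qed.

Lemma Inv_memP J x : Inv R J ->
  J x <-> forall M, sr_maximal R M -> val_ge (v M) (ideal_val J M) x.
Proof.
move=> iJ; split=> [Jx M mM|Jx]; first exact: ideal_val_ge.
have [J' [iJ' JJ' J'E]] := Inv_val_inverse iJ; have [[J0 [JD [JM _]]] _] := iJ.
suff JJ'x y : prod_set J J' y -> J (x * y).
  by rewrite -[x]mulr1; apply: JJ'x; rewrite JJ'; case: sR.
move: y; apply: (@prod_set_sub _ _ _ [set y | J (x * y)]) => /=.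
- by rewrite mulr0.
- by move=> y z; rewrite mulrDr; exact: JD.
- move=> a b Ja J'b; rewrite (mulrC a) mulrA; apply: JM => //.
  apply: (mem_ring_locally sR vR) => M mM; have [dM _] := vR mM.
  rewrite -(subrr (ideal_val J M)).
  apply: (val_geM dM (Jx M mM)); have := ideal_val_ge iJ' mM J'b; by rewrite J'E.
Qed.

Lemma ideal_val_inj J L : Inv R J -> Inv R L -> ideal_val J = ideal_val L -> J = L.
Proof.
move=> iJ iL e; apply/seteqP; split=> x.
  by move=> /(Inv_memP _ iJ); rewrite e => /(Inv_memP _ iL).
by move=> /(Inv_memP _ iL); rewrite -e => /(Inv_memP _ iJ).
Qed.

Lemma frac_ideal_cap_max_val J L M m n : sr_maximal R M -> frac_ideal R J -> frac_ideal R L ->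
  min_val (v M) J m -> min_val (v M) L n ->
  exists t, [/\ (J `&` L) t, t != 0 & v M t = Num.max m n].
Proof.
move=> mM; have [dM _] := vR mM; wlog mn : J L m n / m <= n.
  move=> sym fJ fL Jm Ln; have /orP[mn|nm] := le_total m n; first exact: (sym J L m n).
  by have [t] := sym L J n m nm fL fJ Ln Jm; rewrite setIC maxC; exists t.
move=> [_ [_ [JM _]]] [_ [_ [LM _]]] [_ [x [Jx x0 vx]]] [_ [y [Ly y0 vy]]].
have [|t [Rt nMt Rtyx]] := local_denominator vR mM (x := y / x).
  by right; rewrite valM ?invr_eq0 // valV // vx vy; lia.
have [t0 vt] := val_unit sR vR mM Rt nMt; exists (t * y); split.
- by split; [rewrite -[y](divfK x0) mulrA; exact: JM|exact: LM].
- exact: mulf_neq0.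
- by rewrite valM // vt vy add0r; lia.
Qed.

(* The inverse of [J + L] is [(J `&` L) J^-1 L^-1]. *)
Lemma Inv_add J L : Inv R J -> Inv R L -> Inv R (addset J L).
Proof.
move=> iJ iL; have [J' [iJ' JJ' J'E]] := Inv_val_inverse iJ.
have [L' [iL' LL' L'E]] := Inv_val_inverse iL; have [R1 [RB RM]] := sR.
have [[fJ _] [fL _]] := (iJ, iL); have fJ'L' := frac_ideal_prod sR iJ'.1 iL'.1.
have fP := frac_ideal_prod sR (frac_ideal_cap fJ fL) fJ'L'.
split; first exact: frac_ideal_add.
exists (prod_set (J `&` L) (prod_set J' L')); split=> //.
have [I0 [ID [IM _]]] := frac_ideal_prod sR (frac_ideal_add sR fJ fL) fP.
apply: (sr_ideal_full_locally sR).
  split=> //; apply: prod_set_sub => [||s p Js]; [exact: subring0|by move=> x y; exact: subringD|].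
  move: p; apply: (@prod_set_sub _ _ _ [set p | R (s * p)]) => /= [|x y|t q [Jt Lt]].
  - by rewrite mulr0; exact: subring0.
  - by rewrite mulrDr; exact: subringD.
  move: q; apply: (@prod_set_sub _ _ _ [set q | R (s * (t * q))]) => /= [|x y|j l J'j L'l].
  - by rewrite !mulr0; exact: subring0.
  - by rewrite !mulrDr; exact: subringD.
  have Rj a : J a -> R (a * j) by move=> Ja; rewrite -JJ'; exact: prod_set_mul.
  have Rl a : L a -> R (a * l) by move=> La; rewrite -LL'; exact: prod_set_mul.
  have [a Ja [b Lb <-]] := Js; rewrite mulrDl; apply: subringD => //.
    by rewrite (_ : _ * _ = a * j * (t * l)); [apply: RM; [exact: Rj|exact: Rl]|ring].
  by rewrite (_ : _ * _ = t * j * (b * l)); [apply: RM; [exact: Rj|exact: Rl]|ring].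
move=> M mM; have [dM _] := vR mM; have [Jm Ln] := (ideal_valP iJ mM, ideal_valP iL mM).
have [_ [s [Ss s0 vs]]] := min_val_add dM fJ.1 fL.1 Jm Ln.
have [t [JLt t0 vt]] := frac_ideal_cap_max_val mM fJ fL Jm Ln.
have [[_ [j [J'j j0 vj]]] [_ [l [L'l l0 vl]]]] := (ideal_valP iJ' mM, ideal_valP iL' mM).
have stjl0 : s * (t * (j * l)) != 0 by rewrite !mulf_neq0.
have Pstjl : prod_set (addset J L) (prod_set (J `&` L) (prod_set J' L')) (s * (t * (j * l))).
  by apply: prod_set_mul => //; apply: prod_set_mul => //; exact: prod_set_mul.
exists (s * (t * (j * l))) => // Mstjl.
have /(maximal_valP sR vR mM (maximal_sub mM Mstjl)) := Mstjl.
rewrite val_geE // !valM ?mulf_neq0 // vs vt vj vl J'E L'E.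
rewrite -[(- ideal_val J) M]/(- ideal_val J M) -[(- ideal_val L) M]/(- ideal_val L M); lia.
Qed.

Lemma ideal_val_add J L : Inv R J -> Inv R L ->
  ideal_val (addset J L) = ideal_val J \min ideal_val L.
Proof.
move=> iJ iL; apply/funext => M /=; have [[J0 _] _] := iJ; have [[L0 _] _] := iL.
have [mM|nM] := pselect (sr_maximal R M); last by rewrite !ideal_val_off // minxx.
apply: ideal_valE => //.
by apply: min_val_add; [case: (vR mM)| | |exact: ideal_valP|exact: ideal_valP].
Qed.

Lemma ideal_val_principal a M : a != 0 -> sr_maximal R M ->
  ideal_val [set r * a | r in R] M = v M a.
Proof.
move=> a0 mM; have [dM _] := vR mM; apply: ideal_valE => //; split=> [_ [r Rr <-]|].
  by apply: (val_geMl dM); [exact: (ring_val_ge sR vR mM)|right].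
by exists a; split=> //; exists 1; rewrite ?mul1r //; case: sR.
Qed.

Definition value_group : set (set K -> int) := ideal_val @` Inv R.

Lemma subgroup_value_group : subgroup value_group.
Proof.
split; first by exists R; [exact: Inv_ring|exact: ideal_val_ring].
move=> _ _ [J iJ <-] [L iL <-]; have [L' [iL' _ L'E]] := Inv_val_inverse iL.
by exists (prod_set J L'); [exact: Inv_prod|rewrite ideal_val_prod // L'E].
Qed.

Lemma value_group_min g h : value_group g -> value_group h -> value_group (g \min h).
Proof.
move=> [J iJ <-] [L iL <-]; exists (addset J L); first exact: Inv_add.
exact: ideal_val_add.
Qed.

Lemma value_group_off g M : value_group g -> ~ sr_maximal R M -> g M = 0.
Proof. by move=> [J iJ <-]; exact: ideal_val_off. Qed.

Lemma ideal_val_set_iso : set_iso (Inv R) value_group (@prod_set K) +%R ideal_val.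
Proof.
split; first by move=> J iJ; exists J.
split; first exact: ideal_val_inj.
split; first by move=> _ [J iJ <-]; exists J.
exact: ideal_val_prod.
Qed.

(* [g] is the value function of the fractional ideal generated by [s]. *)
Definition val_generated (s : seq K) (g : set K -> int) := forall M n, sr_maximal R M ->
  n <= g M <-> {in s, forall x, val_ge (v M) n x}.

Lemma val_generated_filter s g : val_generated [seq x <- s | x != 0] g -> val_generated s g.
Proof.
move=> gs M n mM; rewrite gs //; split=> sn x; last by rewrite mem_filter => /andP[_ /sn].
by have [->|x0] := eqVneq x 0; [left|move=> xs; apply: sn; rewrite mem_filter x0].
Qed.

Lemma value_group_of_nonzero a s : a != 0 -> all (fun x => x != 0) s ->
  exists2 g, value_group g & val_generated (a :: s) g.
Proof.
elim: s a => [|b s IHs] a a0 s0; pose ga := ideal_val [set r * a | r in R].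
  exists ga => [|M n mM]; first by exists [set r * a | r in R]; first exact: Inv_principal.
  rewrite /ga ideal_val_principal // -val_geE //; split=> [na x|]; first by rewrite inE => /eqP ->.
  by apply; rewrite inE.
have /andP[/IHs /[apply] [[g Gg gs]]] := s0.
have Ga : value_group ga by exists [set r * a | r in R]; first exact: Inv_principal.
exists (ga \min g) => [|M n mM]; first exact: value_group_min.
rewrite /= le_min /ga ideal_val_principal //; split=> [/andP[na /gs ns] x|ns].
  by rewrite inE => /orP[/eqP ->|xs]; [right|exact: ns].
apply/andP; split; first by apply/val_geE => //; apply: ns; rewrite inE eqxx.
by apply/gs => // x xs; apply: ns; rewrite inE xs orbT.
Qed.

Lemma value_group_of_seq s : has (fun x => x != 0) s ->
  exists2 g, value_group g & val_generated s g.
Proof.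
move=> s0; suff [g Gg gs] : exists2 g, value_group g & val_generated [seq x <- s | x != 0] g.
  by exists g; rewrite //; exact: val_generated_filter.
have : all (fun x => x != 0) [seq x <- s | x != 0] by exact: filter_all.
move: s0; rewrite has_filter; case: [seq x <- s | x != 0] => // a t _ /andP[].
exact: value_group_of_nonzero.
Qed.

Lemma value_group_generators g : value_group g ->
  exists2 s, has (fun x => x != 0) s & val_generated s g.
Proof.
move=> [J iJ <-]; have [x0 Jx0 nx0] := Inv_nonzero sR iJ.
have [J' [iJ' JJ' J'E]] := Inv_val_inverse iJ.
have [s [sJ s1]] : prod_set J J' 1 by rewrite JJ'; case: sR.
have s'J : {in x0 :: map fst s, forall x, J x}.
  by move=> x; rewrite inE => /orP[/eqP -> //|/mapP [p /sJ [? _] ->]].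
exists (x0 :: map fst s); first by rewrite /= nx0.
move=> M n mM; have [dM _] := vR mM; split=> [nJ x /s'J Jx|sn].
  by apply: val_ge_le nJ _; exact: ideal_val_ge.
have : val_ge (v M) (n + ideal_val J' M) 1.
  rewrite s1 big_seq; apply: (big_ind (val_ge (v M) (n + ideal_val J' M))).
  - exact: val_ge0.
  - by move=> x y; exact: val_geD.
  - move=> p ps; apply: (val_geM dM); first by apply: sn; rewrite inE map_f ?orbT.
    by apply: ideal_val_ge => //; case: (sJ p ps).
rewrite val_geE ?oner_neq0 // val1 // J'E -[(- _) M]/(- ideal_val J M); lia.
Qed.

End ValueGroup.

(** * The inverse topology *)

Section InverseTopology.
Variables (K : fieldType) (R : set K).
Hypothesis sR : subring R.
Implicit Types (P M N : set K) (s : seq K) (a : K).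

Definition basic_open a : set (set K) := [set P | sr_prime R P /\ ~ P a].

Lemma basic_openD a b : basic_open (a + b) `<=` basic_open a `|` basic_open b.
Proof.
move=> P [pP nPab]; have [Pa|nPa] := pselect (P a); last by left.
by right; split=> // Pb; apply: nPab; case: pP => -[_ [_ [PD _]]] _; exact: PD.
Qed.

Lemma basic_openM a b : R a -> basic_open (a * b) `<=` basic_open b.
Proof.
move=> Ra P [pP nPab]; split=> // Pb; apply: nPab.
by case: pP => -[_ [_ [_ PM]]] _; exact: PM.
Qed.

Lemma zar_open_basic_open a : R a -> zar_open R (basic_open a).
Proof.
move=> Ra; exists [set a]; split; first by move=> _ ->.
apply/seteqP; split=> P [pP nPa]; split=> // Pa; apply: nPa; first exact: Pa.
by move=> _ ->.
Qed.

Lemma zar_open_basis V P : zar_open R V -> V P -> exists a, [/\ R a, ~ P a & basic_open a `<=` V].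
Proof.
move=> [S [SR ->]] [pP /existsNP [a /not_implyP [Sa nPa]]].
exists a; split=> // [|Q [pQ nQa]]; first exact: SR.
by split=> // /(_ a Sa).
Qed.

Lemma compact_basic_open a : R a -> compact_in (zar_open R) (basic_open a).
Proof.
move=> Ra; apply/compact_inP => J [J0 JU JS] locJ; pose I := [set x | R x /\ J (basic_open x)].
have [_ [_ RM]] := sR.
have idI : sr_ideal R I.
  split; first by move=> x [].
  split.
    split; first exact: subring0.
    by apply: JS J0 => P [[[_ [P0 _]] _]].
  split=> [x y [Rx Jx] [Ry Jy]|r x Rr [Rx Jx]].
    split; first exact: subringD.
    by apply: JS (JU _ _ Jx Jy); exact: basic_openD.
  by split; [exact: RM|apply: JS Jx; exact: basic_openM].
have [[n [_ Jan]]|nI] := pselect (exists n, I (a ^+ n)).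
  by apply: JS Jan => P [pP nPa]; split=> // /(sr_prime_exp sR pP Ra).
have [|P [pP IP nPa]] := exists_sr_prime_avoiding sR idI Ra.
  by move=> n Ian; apply: nI; exists n.
have [V [zV VP JV]] := locJ P (conj pP nPa); have [b [Rb nPb bV]] := zar_open_basis zV VP.
by case: nPb; apply: IP; split=> //; exact: JS JV.
Qed.

Definition prime_hull s : set (set K) := [set P | sr_prime R P /\ {in s, forall x, P x}].

Lemma compact_zar_open_hull V P : zar_open R V -> compact_in (zar_open R) V ->
  sr_prime R P -> ~ V P -> exists2 s, {in s, forall x, P x} & prime_hull s `<=` Spec R `\` V.
Proof.
move=> [S [SR VE]] /compact_inP cV pP nVP.
have SP : S `<=` P by apply: contrapT => nSP; apply: nVP; rewrite VE.
pose J := [set W : set (set K) | exists2 s : seq K, {in s, forall x, S x} &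
  W `<=` [set Q | exists2 x, x \in s & ~ Q x]].
have [s sS sV] : J V.
  apply: cV.
    split=> [|W W' [s sS sW] [s' sS' sW']|W W' WW' [s sS sW]]; first by exists [::].
      exists (s ++ s') => [x|Q]; first by rewrite mem_cat => /orP[/sS|/sS'].
      by move=> [/sW|/sW'] [x xs nQx]; exists x; rewrite // mem_cat xs ?orbT.
    by exists s => //; exact: subset_trans sW.
  move=> Q; rewrite VE => -[pQ /existsNP [a /not_implyP [Sa nQa]]].
  exists (basic_open a); split=> //; first by apply: zar_open_basic_open; exact: SR.
  by exists [:: a] => [x|Q' [_ nQ'a]]; [rewrite inE => /eqP ->|exists a; rewrite ?inE].
exists s => [x /sS /SP //|Q [pQ sQ]]; split=> // /sV [x xs]; apply; exact: sQ.
Qed.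

Lemma inv_openP U : inv_open R U <-> U `<=` Spec R /\
  forall P, U P -> exists2 s, {in s, forall x, P x} & prime_hull s `<=` U.
Proof.
split=> -[USpec Uop]; split=> // P UP.
  have [l [lSub [pP [lP lU]]]] := Uop P UP.
  suff [s sP sl] : exists2 s, {in s, forall x, P x} &
      prime_hull s `<=` [set Q | forall B, List_In B l -> B Q].
    by exists s => // Q hQ; apply: lU; split; [case: hQ|exact: sl].
  elim: l lSub lP {lU} => [|B l IHl] lSub lP; first by exists [::] => // Q _ B [].
  have [|B' lB'|s sP sl] := IHl; [by move=> B' lB'; apply: lSub; right|by apply: lP; right|].
  have [V [zV [cV BE]]] := lSub B (or_introl erefl).
  have /= := lP B (or_introl erefl); rewrite {1}BE => -[_ nVP].
  have [t tP tV] := compact_zar_open_hull zV cV pP nVP.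
  exists (s ++ t) => [x|Q [pQ stQ] B' [<-|lB']]; first by rewrite mem_cat => /orP[/sP|/tP].
    by rewrite BE; apply: tV; split=> // x xt; apply: stQ; rewrite mem_cat xt orbT.
  by apply: sl lB'; split=> // x xs; apply: stQ; rewrite mem_cat xs.
have [s sP sU] := Uop P UP; have pP := USpec P UP; have PR : P `<=` R by case: pP => -[].
exists [seq Spec R `\` basic_open a | a <- s]; split.
  move=> B /List.in_map_iff [a [<- /List_InP /sP /PR Ra]].
  exists (basic_open a); split; first exact: zar_open_basic_open.
  by split=> //; exact: compact_basic_open.
split=> //; split=> [B /List.in_map_iff [a [<- /List_InP /sP Pa]]|Q [pQ sQ]].
  by split=> // -[].
apply: sU; split=> // a sa; apply: contrapT => nQa.
have : (Spec R `\` basic_open a) Q.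
  by apply: sQ; apply/List.in_map_iff; exists a; split=> //; apply/List_InP.
by move=> [_]; apply.
Qed.

Definition max_hull s : set (set K) := [set N | sr_maximal R N /\ {in s, forall x, N x}].

Lemma maxtopP W : maxtop R W <-> W `<=` Max R /\
  forall M, W M -> exists2 s, {in s, forall x, M x} & max_hull s `<=` W.
Proof.
split=> [[U [/inv_openP [USpec Uop] ->]]|[WMax Wop]].
  split=> [M [] //|M [UM mM]]; have [s sM sU] := Uop M UM; exists s => // N [mN sN].
  by split=> //; apply: sU; split=> //; exact: sr_maximal_prime.
exists [set P | sr_prime R P /\ exists2 s, {in s, forall x, P x} & max_hull s `<=` W]; split.
  apply/inv_openP; split=> [P [] //|P [pP [s sP sW]]].
  by exists s => // Q [pQ sQ]; split=> //; exists s.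
apply/seteqP; split=> [M WM|M [[_ [s sM sW]] mM]]; last by apply: sW.
by split; [split; [apply: sr_maximal_prime => //; exact: WMax|exact: Wop]|exact: WMax].
Qed.

End InverseTopology.

Lemma ultra_limit_prime (K : fieldType) (R : set K) (U : set_system (set K)) :
  subring R -> UltraFilter U -> U (Max R) ->
  sr_prime R [set x | R x /\ U [set M | M x]].
Proof.
move=> sR UU Umax; have [R1 [RB RM]] := sR.
split.
  split; first by move=> x [].
  split; first by split; [exact: subring0|apply: filterS Umax => M [[_ []]]].
  split=> [x y [Rx Ux] [Ry Uy]|r x Rr [Rx Ux]].
    split; first exact: subringD.
    by apply: filterS3 Umax Ux Uy => M [[_ [_ [MD _]]] _]; exact: MD.
  split; first exact: RM.
  by apply: filterS2 Umax Ux => M [[_ [_ [_ MM]]] _]; exact: MM.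
split=> [e|a b Ra Rb [_ Uab]].
  have [_ U1] : [set x | R x /\ U [set M | M x]] 1 by rewrite e.
  have [M [[idM [MR _]] M1]] := filter_ex (filterI Umax U1).
  exact: sr_ideal_proper idM MR M1.
have [Ua|nUa] := in_ultra_setVsetC [set M | M a] UU; [by left|right; split=> //].
apply: filterS3 Umax Uab nUa => M mM Mab nMa.
by have [_ [_ Mprime]] := sr_maximal_prime sR mM; have [] := Mprime _ _ Ra Rb Mab.
Qed.

Section ValueGroupTopology.
Variables (K : fieldType) (R : set K) (v : set K -> K -> int).
Hypotheses (sR : subring R) (qR : quotient_field_of R) (vR : local_valuations R v).
Let G := value_group R v.
Let sG : subgroup G. Proof. exact: subgroup_value_group. Qed.
Implicit Types (g h : set K -> int) (M N : set K).

Lemma pos_set_maximal g M : G g -> pos_set g M -> sr_maximal R M.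
Proof.
move=> Gg; rewrite /pos_set /= => gM.
by apply: contrapT => /(value_group_off Gg) g0; lia.
Qed.

Lemma value_group_max g h : G g -> G h -> G (g \max h).
Proof. by apply: min_closed_max sG _ _ _; exact: value_group_min. Qed.

Lemma value_group_pos_seq g : G g -> exists s : seq K,
  [/\ {in s, forall x, R x}, has (fun x => x != 0) s &
      forall M, sr_maximal R M -> 0 < g M <-> {in s, forall x, M x}].
Proof.
move=> Gg; have [s s0 gs] := value_group_generators sR vR (value_group_max Gg sG.1).
have sR' : {in s, forall x, R x}.
  move=> x xs; apply: (mem_ring_locally sR vR) => M mM; move: x xs; apply/gs => //=.
  by rewrite le_max lexx orbT.
exists s; split=> // M mM.
have -> : 0 < g M <-> 1 <= (g \max 0) M by rewrite /= -[X in Num.max _ X]/0; lia.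
rewrite gs //; split=> sM x xs; first by apply/(maximal_valP sR vR mM); [exact: sR'|exact: sM].
by apply/(maximal_valP sR vR mM); [exact: sR'|exact: sM].
Qed.

Lemma value_group_of_maximal (s : seq K) M : sr_maximal R M -> {in s, forall x, M x} ->
  exists g, [/\ G g, 0 < g M & pos_set g `<=` max_hull R s].
Proof.
move=> mM sM; have [t [Mt t0 _]] := exists_uniformizer sR vR mM.
have MR := maximal_sub mM.
have [|g Gg gts] := value_group_of_seq sR qR vR (s := t :: s); first by rewrite /= t0.
exists g; split=> // [|N gN].
  suff : 1 <= g M by lia.
  apply/gts => // x; rewrite inE => /orP[/eqP ->|/sM Mx];
    by apply/(maximal_valP sR vR mM) => //; exact: MR.
have mN := pos_set_maximal Gg gN.
split=> // x xs; apply/(maximal_valP sR vR mN); first by apply: MR; exact: sM.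
have : 1 <= g N by move: gN; rewrite /pos_set /=; lia.
by move=> /(gts N 1 mN); apply; rewrite inE xs orbT.
Qed.

Lemma maxtopE : maxtop R = pos_topology (Max R) G.
Proof.
apply/seteqP; split=> W => [/(maxtopP sR) [WMax Wop]|[WMax Wop]].
  split=> // M WM; have [s sM sW] := Wop M WM.
  have [g [Gg gM gs]] := value_group_of_maximal (WMax M WM) sM.
  by exists g; split=> //; exact: subset_trans sW.
apply/(maxtopP sR); split=> // M WM; have [g [Gg gM gW]] := Wop M WM.
have [s [_ _ gs]] := value_group_pos_seq Gg; exists s; first exact/gs/gM/WMax.
by move=> N [mN sN]; apply: gW; exact/gs.
Qed.

(* If [pos_set g] is not in the ideal [J], an ultrafilter containing it and the
   complements of the members of [J] has a limit, a maximal ideal in [pos_set g]. *)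
Lemma value_group_compact g J : G g -> set_ideal J ->
  (forall M, 0 < g M -> exists h, [/\ G h, 0 < h M & J (pos_set h)]) -> J (pos_set g).
Proof.
move=> Gg [J0 JU JS] locJ; apply: contrapT => nJg.
pose F : set_system (set K) := [set A | J (pos_set g `\` A)].
have FF : ProperFilter F.
  apply: Build_ProperFilter; first by rewrite /F /= setD0.
  split=> [|A B FA FB|A B AB FA]; rewrite /F /=.
  - by rewrite setDT.
  - by rewrite setDIr; exact: JU.
  - by apply: JS FA; exact: setDS.
have [U [UU FU]] := ultraFilterLemma FF.
have Ug : U (pos_set g) by apply: FU; rewrite /F /= setDv.
have Umax : U (Max R) by apply: filterS Ug => M; exact: pos_set_maximal.
have [s [sR' s0 gs]] := value_group_pos_seq Gg.
pose P := [set x | R x /\ U [set M | M x]].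
have sP : {in s, forall x, P x}.
  move=> x xs; split; first exact: sR'.
  by apply: filterS2 Umax Ug => M mM /(gs M mM); apply.
have [a sa a0] := hasP s0.
have mP := prime_nonzero_maximal sR vR (ultra_limit_prime sR UU Umax) (sP a sa) a0.
have [h [Gh hP Jh]] := locJ P ((gs P mP).2 sP).
have [t [_ _ ht]] := value_group_pos_seq Gh.
have Ut : U (max_hull R t).
  have : {in t, forall x, P x} by exact/(ht P mP).
  elim: t {ht} => [|x t IHt] tP; first by apply: filterS Umax => M.
  have [_ Ux] := tP x (mem_head _ _).
  have Ut : U (max_hull R t) by apply: IHt => y yt; apply: tP; rewrite inE yt orbT.
  by apply: filterS2 Ux Ut => M Mx [mM Mt]; split=> // y; rewrite inE => /orP[/eqP ->|/Mt].
have Unh : U (~` pos_set h).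
  by apply: FU; apply: JS Jh; rewrite setDE setCK => M [].
by have [M [[mM /(ht M mM) hM] nhM]] := filter_ex (filterI Ut Unh).
Qed.

Lemma compact_lgroup_value_group : compact_lgroup (Max R) G.
Proof.
split; [exact: sG|exact: value_group_min|exact: value_group_off|exact: value_group_compact].
Qed.

End ValueGroupTopology.

(** * Critical ideals of overrings *)

Section FinitelyGeneratedIdeals.
Variables (K : fieldType) (S : set K).
Hypothesis sS : subring S.

Definition fg_span (s : seq K) : set K := [set x | exists c : seq K,
  (forall y, y \in c -> S y) /\ size c = size s /\ x = \sum_(i < size s) c`_i * s`_i].

Lemma fg_span_sub s I : sr_ideal S I -> {in s, forall x, I x} -> fg_span s `<=` I.
Proof.
move=> [_ [I0 [ID IM]]] sI _ [c [cS [sc ->]]]; apply: (big_ind I) => // i _.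
by apply: IM; [apply: cS; rewrite mem_nth // sc|apply: sI; rewrite mem_nth].
Qed.

Lemma mem_fg_span s x : x \in s -> fg_span s x.
Proof.
move=> xs; have [S1 _] := sS; exists (mkseq (fun i => (i == index x s)%:R) (size s)).
split; first by move=> y /mapP [i _ ->]; case: (_ == _); rewrite //; exact: subring0.
split; first by rewrite size_mkseq.
have si : (index x s < size s)%N by rewrite index_mem.
rewrite (bigD1 (Ordinal si)) //= nth_mkseq // eqxx mul1r nth_index // big1 ?addr0 // => i ne.
by rewrite nth_mkseq // [(_ == _)](negbTE (_ : val i != val (Ordinal si))) // mul0r.
Qed.

End FinitelyGeneratedIdeals.

Section Overring.
Variables (K : fieldType) (R : set K) (v : set K -> K -> int).
Hypotheses (sR : subring R) (qR : quotient_field_of R) (vR : local_valuations R v).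
Let G := value_group R v.
Variable C : set (set K).
Hypothesis clC : pos_closed (Max R) G C.
Let T := Tof R C.
Implicit Types P Q N : set K.

Let C_max Q : C Q -> sr_maximal R Q. Proof. by case: clC => CMax _ /CMax. Qed.

Let C_val Q : C Q -> discrete_valuation (v Q). Proof. by move=> /C_max /vR []. Qed.

Lemma TofP x : T x <-> forall Q, C Q -> val_ge (v Q) 0 x.
Proof. by split=> Tx Q CQ; have := Tx Q CQ; have [_ ->] := vR (C_max CQ). Qed.

Lemma sub_Tof : R `<=` T.
Proof. by move=> x Rx; apply/TofP => Q /C_max mQ; exact: ring_val_ge mQ _ Rx. Qed.

Lemma subring_Tof : subring T.
Proof.
have [R1 [RB RM]] := sR; split; first exact: sub_Tof.
split=> x y /TofP Tx /TofP Ty; apply/TofP => Q CQ; have dQ := C_val CQ.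
  apply: (val_geD dQ); first exact: Tx.
  rewrite -mulN1r; apply: (val_geMl dQ); last exact: Ty.
  by apply: (ring_val_ge sR vR (C_max CQ)); apply: subgroupN => //; exact: subring_subgroup.
by apply: (val_geMl dQ); [exact: Tx|exact: Ty].
Qed.

Let TM x y : T x -> T y -> T (x * y).
Proof. by case: subring_Tof => _ [_]; apply. Qed.

Lemma sr_ideal_val_ge Q n : C Q -> sr_ideal T (T `&` val_ge (v Q) n).
Proof.
move=> CQ; have dQ := C_val CQ; split; first by move=> x [].
split; first by split; [apply: sub_Tof; exact: subring0|exact: val_ge0].
split=> [x y [Tx nx] [Ty ny]|s x Ts [Tx nx]].
  by split; [exact: (subringD subring_Tof)|exact: (val_geD dQ)].
by split; [exact: TM|apply: (val_geMl dQ) => //; move/TofP: Ts; apply].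
Qed.

(* Clear the denominator of x / p^k at Q by some t, and write 1 = c t + q. *)
Lemma Tof_decomposition Q p (k : nat) x : C Q -> p != 0 -> v Q p = 1 ->
  T x -> val_ge (v Q) k x -> exists r q, [/\ R r, Q q & x = r * p ^+ k + q * x].
Proof.
move=> CQ p0 vp Tx kx; have [mQ dQ] := (C_max CQ, C_val CQ); have pk0 := expf_neq0 k p0.
have [|t [Rt nQt Rtx]] := local_denominator vR mQ (x := x / p ^+ k).
  rewrite -(subrr k%:Z); apply: (val_geM dQ kx).
  by right; rewrite (valV dQ) // (valX dQ) // vp natz.
have [c [q [Rc Qq e]]] := sr_maximal_comax sR mQ Rt nQt.
exists (c * (t * (x / p ^+ k))), q; split=> //; first by case: sR => _ [_]; apply.
by rewrite -[LHS]mul1r e mulrDl; congr (_ + _); field.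
Qed.

Lemma extensionE Q : C Q -> prod_set Q T = T `&` val_ge (v Q) 1.
Proof.
move=> CQ; have mQ := C_max CQ; apply/seteqP; split=> [|x [Tx v1]].
  have [_ [I0 [ID IM]]] := sr_ideal_val_ge 1 CQ.
  apply: prod_set_sub => // a b Qa Tb; rewrite mulrC; apply: IM => //.
  have Ra : R a by exact: maximal_sub mQ _ Qa.
  by split; [exact: sub_Tof|exact/(maximal_valP sR vR mQ)].
have [p [Qp p0 vp]] := exists_uniformizer sR vR mQ.
have [r [q [Rr Qq ->]]] := Tof_decomposition CQ p0 vp Tx v1.
by apply: prod_setD; [rewrite expr1 mulrC|]; apply: prod_set_mul => //; exact: sub_Tof.
Qed.

Lemma extension_sqrE Q : C Q ->
  prod_set (prod_set Q T) (prod_set Q T) = T `&` val_ge (v Q) 2.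
Proof.
move=> CQ; have [mQ dQ] := (C_max CQ, C_val CQ); apply/seteqP; split=> [|x [Tx v2]].
  have [_ [I0 [ID _]]] := sr_ideal_val_ge 2 CQ; apply: prod_set_sub => // a b.
  by rewrite (extensionE CQ) => -[Ta va] [Tb vb]; split; [exact: TM|exact: (val_geM dQ va vb)].
have T1 : T 1 by case: subring_Tof.
have [p [Qp p0 vp]] := exists_uniformizer sR vR mQ.
have [r [q [Rr Qq e]]] := Tof_decomposition CQ p0 vp Tx v2.
have QT a : Q a -> prod_set Q T a by move=> Qa; rewrite -[a]mulr1; exact: prod_set_mul.
have QTx : prod_set Q T x by rewrite extensionE //; split=> //; exact: val_ge_le v2.
rewrite e; apply: prod_setD; last by apply: prod_set_mul => //; exact: QT.
rewrite expr2 mulrA mulrC; apply: prod_set_mul; first exact: QT.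
by rewrite mulrC; apply: prod_set_mul => //; exact: sub_Tof.
Qed.

Lemma sr_ideal_extension P : sr_maximal R P -> sr_ideal T (prod_set P T).
Proof.
move=> mP; split; last split; last split; [|exact: prod_set0|by move=> x y; exact: prod_setD|].
  apply: prod_set_sub; first by apply: sub_Tof; exact: subring0.
    by move=> x y; exact: (subringD subring_Tof).
  by move=> a b /(maximal_sub mP) /sub_Tof; exact: TM.
by move=> s x Ts; apply: prod_set_scaler => b; exact: TM.
Qed.

Lemma sr_maximal_extension Q : C Q -> sr_maximal T (prod_set Q T).
Proof.
move=> CQ; have [mQ dQ] := (C_max CQ, C_val CQ); have [R1 [RB RM]] := sR.
split; first exact: sr_ideal_extension.
split=> [e|J idJ QJ]; first have : prod_set Q T 1 by rewrite e; exact: sub_Tof.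
  by rewrite extensionE // => -[_ /(val_ge1_proper dQ)].
have [_ [_ [JD JM]]] := idJ; have [JT _] := idJ.
have [JQ|nJQ] := pselect (J `<=` prod_set Q T); [by left; apply/seteqP|right].
have /existsNP [x /not_implyP [Jx nQx]] := nJQ; have Tx := JT x Jx.
have [t [Rt nQt Rtx]] := local_denominator vR mQ ((TofP x).1 Tx Q CQ).
have nQtx : ~ Q (t * x).
  move=> /(maximal_valP sR vR mQ Rtx) v1; apply: nQx; rewrite extensionE //; split=> //.
  have [->|x0] := eqVneq x 0; [exact: val_ge0|apply/val_geE => //].
  have [t0 vt] := val_unit sR vR mQ Rt nQt.
  by move: v1; rewrite val_geE ?mulf_neq0 // valM // vt add0r.
have [c [q [Rc Qq e]]] := sr_maximal_comax sR mQ Rtx nQtx.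
apply: sr_ideal_full => //; rewrite e; apply: JD.
  by rewrite mulrA; apply: JM => //; apply: sub_Tof; exact: RM.
by apply: QJ; rewrite -[q]mulr1; apply: prod_set_mul => //; exact: sub_Tof.
Qed.

Lemma extension_trivial P : sr_maximal R P -> ~ C P -> prod_set P T 1.
Proof.
move=> mP nCP; have [_ [_ /(_ P (conj mP nCP)) [g [Gg gP gC]]]] := clC.
have [J iJ JE] := value_group_max sR vR Gg (subgroup_value_group sR vR).1.
have [J' [iJ' JJ' J'E]] := Inv_val_inverse sR vR iJ.
have JP : J `<=` P.
  move=> x Jx; have vx M : sr_maximal R M -> val_ge (v M) (Num.max (g M) 0) x.
    by move=> mM; have := ideal_val_ge sR vR iJ mM Jx; rewrite JE.
  apply/(maximal_valP sR vR mP); last by apply: val_ge_le (vx P mP); lia.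
  by apply: (mem_ring_locally sR vR) => M mM; apply: val_ge_le (vx M mM); lia.
have J'T : J' `<=` T.
  move=> x J'x; apply/TofP => Q CQ; apply: val_ge_le (ideal_val_ge sR vR iJ' (C_max CQ) J'x).
  rewrite J'E JE -[(- _) Q]/(- Num.max (g Q) 0).
  have gQ : ~ 0 < g Q by move=> /gC [].
  by lia.
have : prod_set J J' 1 by rewrite JJ'; case: sR.
apply: prod_set_sub; [exact: prod_set0|by move=> x y; exact: prod_setD|].
by move=> a b /JP Pa /J'T Tb; exact: prod_set_mul.
Qed.

Lemma sr_maximal_Tof N : C !=set0 -> sr_maximal T N -> exists2 Q, C Q & N = prod_set Q T.
Proof.
move=> [Q0 CQ0] mN; have [idN [NT maxN]] := mN; have [_ [N0 [ND NM]]] := idN.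
have pNR := sr_prime_contract sR sub_Tof (sr_maximal_prime subring_Tof mN).
have [a [Na Ra] a0] : exists2 a, (N `&` R) a & a != 0.
  apply: contrapT => nex; have N_eq0 x : N x -> x = 0.
    move=> Nx; have [a [b [Ra [Rb [b0 xE]]]]] := qR x; apply: contrapT => /eqP x0.
    have aE : a = b * x by rewrite xE mulrC divfK.
    apply: nex; exists a; last by rewrite aE mulf_neq0.
    by split=> //; rewrite aE; apply: NM => //; exact: sub_Tof.
  have [t [Qt t0 _]] := exists_uniformizer sR vR (C_max CQ0).
  have Q0t : prod_set Q0 T t.
    by rewrite -[t]mulr1; apply: prod_set_mul => //; apply: sub_Tof; case: sR.
  have [_ [Q0T _]] := sr_maximal_extension CQ0.
  have [x /N_eq0 ->|e|//] := maxN _ (sr_ideal_extension (C_max CQ0)); first exact: prod_set0.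
  by move: Q0t; rewrite e => /N_eq0 /eqP; rewrite (negbTE t0).
have mNR := prime_nonzero_maximal sR vR pNR (conj Na Ra) a0.
have NRT : prod_set (N `&` R) T `<=` N.
  by apply: prod_set_sub => // x y [Nx _] Ty; rewrite mulrC; exact: NM.
have CNR : C (N `&` R).
  by apply: contrapT => /(extension_trivial mNR) /NRT; exact: sr_ideal_proper idN NT.
exists (N `&` R) => //; have [_ [_ max_NRT]] := sr_maximal_extension CNR.
by have [|] := max_NRT N idN NRT.
Qed.

Lemma critical_not_peak P : C P -> critical T (prod_set P T) -> ~ peak_points G C P.
Proof.
move=> CP [_ crit] [_ [g [Gg g01 gP]]]; have [s _ gs] := value_group_generators sR vR Gg.
have sT : {in s, forall x, T x}.
  move=> x xs; apply/TofP => Q CQ; move: x xs; apply/(gs Q 0 (C_max CQ)).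
  by have /andP[] := g01 Q CQ.
have [||N [mN IN]] := crit (fg_span T s); first by exists s.
  rewrite extensionE //; apply: fg_span_sub => [|x xs]; first exact: sr_ideal_val_ge.
  by split; [exact: sT|move: x xs; apply/(gs P 1 (C_max CP)); rewrite gP].
have [|Q CQ NE] := sr_maximal_Tof _ mN; first by exists P.
have : 2 <= g Q; last by have := g01 Q CQ; lia.
apply/(gs Q 2 (C_max CQ)) => x /(mem_fg_span subring_Tof) /IN.
by rewrite NE extension_sqrE // => -[].
Qed.

Lemma not_peak_critical P : C P -> ~ peak_points G C P -> critical T (prod_set P T).
Proof.
move=> CP npk; split; first exact: sr_maximal_extension.
move=> I [s [sT IE]] IP; apply: contrapT => nN; apply: npk; split=> //.
have s_sqr Q : C Q -> ~ {in s, forall x, val_ge (v Q) 2 x}.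
  move=> CQ s2; apply: nN; exists (prod_set Q T); split; first exact: sr_maximal_extension.
  rewrite IE extension_sqrE //; apply: fg_span_sub => [|x xs]; first exact: sr_ideal_val_ge.
  by split; [exact: sT|exact: s2].
have s_nz : has (fun x => x != 0) s.
  apply/negPn/negP => /hasPn s0; apply: (s_sqr P CP) => x /s0.
  by rewrite negbK => /eqP ->; exact: val_ge0.
have [g Gg gs] := value_group_of_seq sR qR vR s_nz.
have g_le1 Q : C Q -> g Q <= 1.
  move=> CQ; have : ~ 2 <= g Q by move=> /(gs Q 2 (C_max CQ)); exact: s_sqr.
  lia.
have g_ge0 Q : C Q -> 0 <= g Q.
  by move=> CQ; apply/(gs Q 0 (C_max CQ)) => x /sT /TofP; apply.
exists g; split=> // [Q CQ|]; first by rewrite g_ge0 ?g_le1.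
apply/eqP; rewrite eq_le g_le1 //=; apply/(gs P 1 (C_max CP)) => x /(mem_fg_span subring_Tof) Ix.
by have : prod_set P T x; [apply: IP; rewrite IE|rewrite extensionE // => -[]].
Qed.

Lemma crit_stepE : crit_step R C = derived G C.
Proof.
apply/seteqP; split=> P [].
  move=> mP [mPT critP]; have CP : C P.
    apply: contrapT => /(extension_trivial mP); have [idP [PT _]] := mPT.
    exact: sr_ideal_proper idP PT.
  by split=> //; exact: critical_not_peak.
by move=> CP npk; split; [exact: C_max|exact: not_peak_critical].
Qed.

End Overring.

Section CriticalSequence.
Variables (K : fieldType) (R : set K) (v : set K -> K -> int).
Hypotheses (sR : subring R) (qR : quotient_field_of R) (vR : local_valuations R v).
Let G := value_group R v.
Variables (d : Order.disp_t) (I : orderType d) (C : I -> set (set K)) (alpha : I).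
Hypotheses (wfI : well_founded (fun x y : I => (x < y)%O)) (critC : crit_seq R C).

Lemma crit_seq_closed i : pos_closed (Max R) G (C i).
Proof.
have cG := compact_lgroup_value_group sR vR; have [Csucc Clim] := critC.
elim/(well_founded_ind wfI): i => i IH.
have [[k ki]|nsucc] := pselect (exists k, is_succ k i).
  have clk : pos_closed (Max R) G (C k) by apply: IH; case: ki.
  by rewrite (Csucc k i ki) (crit_stepE sR qR vR clk); exact: pos_closed_derived cG _ clk.
rewrite Clim => [|j ji]; last by apply: nsucc; exists j.
exact: (pos_closed_bigcap (F := [set j | (j < i)%O])).
Qed.

Lemma crit_seq_derived : derived_seq (Max R) G C.
Proof.
have [Csucc Clim] := critC; split=> // i j ij; rewrite (Csucc i j ij).
exact: crit_stepE (crit_seq_closed i).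
Qed.

Lemma crit_layer_peak i : (i < alpha)%O -> crit_layer C i = peak_points G (C i).
Proof.
move=> ia; have [j ij] := is_succ_exists wfI ia; have [dsucc _] := crit_seq_derived.
apply/seteqP; split=> P [CP].
  move=> nCj; apply: contrapT => npk; apply: (nCj j ij).
  by rewrite (dsucc i j ij).
by move=> pk; split=> // k ik; rewrite (dsucc i k ik) => -[_]; apply.
Qed.

Lemma dsum_crit_layer :
  dsum alpha (fun i => Cc (subspace (maxtop R) (crit_layer C i)) (crit_layer C i)) =
  dsum alpha (fun i => layer_group G (C i)).
Proof.
have cG := compact_lgroup_value_group sR vR.
have CcE i : (i < alpha)%O ->
    Cc (subspace (maxtop R) (crit_layer C i)) (crit_layer C i) = layer_group G (C i).
  move=> ia; rewrite crit_layer_peak // (maxtopE sR qR vR).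
  exact: Cc_layer cG _ (crit_seq_closed i).
by apply/seteqP; split=> f [fG f_fin]; split=> // i ia; have := fG i ia; rewrite CcE.
Qed.

End CriticalSequence.

Theorem theorem5p9 (K : fieldType) (R : set K) (d : Order.disp_t) (I : orderType d)
    (wfI : well_founded (fun x y : I => (x < y)%O))
    (C : I -> set (set K)) (alpha alpha1 : I) :
  almost_dedekind R ->
  crit_seq R C ->
  (* alpha is the SP-rank: least index with Crit_alpha = Crit_{alpha+1} *)
  is_succ alpha alpha1 -> C alpha = C alpha1 ->
  (forall b b1, (b < alpha)%O -> is_succ b b1 -> C b <> C b1) ->
  (* R is SP-scattered *)
  C alpha = set0 ->
  (exists phi : set K -> I -> set K -> int,
     set_iso (Inv R)
       (dsum alpha (fun i => Cc (subspace (maxtop R) (crit_layer C i)) (crit_layer C i)))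
       (@prod_set K) (@dsum_add I (set K)) phi)
  /\ free_abelian (Inv R) (@prod_set K).
Proof.
move=> adR critC _ _ _ C_alpha; have [sR [qR _]] := adR.
have [v vR] := almost_dedekind_valuations adR.
have Inv_iso := ideal_val_set_iso sR vR.
have [[phi phi_iso] G_free] := derived_seq_decomposition (compact_lgroup_value_group sR vR)
  wfI (crit_seq_derived sR qR vR wfI critC) C_alpha.
split; last exact: free_abelian_iso Inv_iso G_free.
exists (phi \o ideal_val R v); rewrite (dsum_crit_layer sR qR vR alpha wfI critC).
exact: set_iso_comp Inv_iso phi_iso.
Qed.
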